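(* Let $(m,Q,v)\in\mathbb{R}\times\mathbb{R}\times C^{1,\alpha}_{2\pi}(\mathbb{R})$ with $[v]=h$. Consider the system consisting of (E1) $$\mathcal{C}_{kh}\big((Q-2gv-\Upsilon^2v^2)v'\big)+(Q-2gv-\Upsilon^2v^2)\Big(\frac1k+\mathcal{C}_{kh}(v')\Big)-2\Upsilon v\Big(\frac{m}{kh}-\frac{\Upsilon}{2kh}[v^2]-\Upsilon\,\mathcal{C}_{kh}(vv')\Big)-\frac{Q-2\Upsilon m-2gh}{k}+2g\,[v\,\mathcal{C}_{kh}(v')]=0\quad\text{on }\mathbb{R},$$ (E2) $$\Big[\Big\{\frac{m}{kh}-\frac{\Upsilon}{2kh}[v^2]-\Upsilon\,\mathcal{C}_{kh}(vv')+\Upsilon v\Big(\frac1k+\mathcal{C}_{kh}(v')\Big)\Big\}^2\Big]-\Big[(Q-2gv)\Big\{(v')^2+\Big(\frac1k+\mathcal{C}_{kh}(v')\Big)^2\Big\}\Big]=0,$$ and consider the single equation (B) $$\Big\{\frac{m}{kh}-\frac{\Upsilon}{2kh}[v^2]-\Upsilon\,\mathcal{C}_{kh}(vv')+\Upsilon v\Big(\frac1k+\mathcal{C}_{kh}(v')\Big)\Big\}^2-(Q-2gv)\Big\{(v')^2+\Big(\frac1k+\mathcal{C}_{kh}(v')\Big)^2\Big\}=0\quad\text{on }\mathbb{R}.$$ (i) If (E1) and (E2) hold, then (B) holds. (ii) If (B) holds and, in addition, $V_x^2+V_y^2\neq0$ in $\overline{\mathcal{R}_{kh}}$, where $V$ is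 the harmonic extension of $v$ to the strip $\mathcal{R}_{kh}$ described in the context, then (E1) and (E2) hold.
   Context: Fixed constants: $g>0$ (gravity), $k>0$ (wave number), $h>0$ (conformal mean depth), $\Upsilon\in\mathbb{R}$ (vorticity), $\alpha\in(0,1)$. $C^{p,\alpha}_{2\pi}(\mathbb{R})$ is the space of $2\pi$-periodic real functions of class $C^{p,\alpha}$. For a $2\pi$-periodic function $f$, $[f]=\frac1{2\pi}\int_{-\pi}^{\pi}f\,dx$ denotes its mean. For $d>0$, the operator $\mathcal{C}_d$ (periodic Hilbert transform of the strip of depth $d$) acts on $2\pi$-periodic functions of zero mean by $$w=\sum_{n\ge1}\big(a_n\cos(nx)+b_n\sin(nx)\big)\ \mapsto\ \mathcal{C}_d(w)=\sum_{n\ge1}\coth(nd)\big(a_n\sin(nx)-b_n\cos(nx)\big);$$ it is a bounded invertible operator on zero-mean functions in $C^{p,\alpha}_{2\pi}(\mathbb{R})$, for every integer $p\ge0$. $\mathcal{R}_{kh}=\{(x,y)\in\mathbb{R}^2:-kh<y<0\}$, and $V$ is the unique solution, $2\pi$-periodic in $x$ and of class $C^{1,\alpha}$ on $\overline{\mathcal{R}_{kh}}$, of $\Delta V=0$ in $\mathcal{R}_{kh}$, $V(x,0)=v(x)$, $V(x,-kh)=0$ for all $x\in\mathbb{R}$. *)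

(* Defs.v *)
From Stdlib Require Import Reals.
From Coquelicot Require Import Coquelicot.
Open Scope R_scope.

(** * Periodic Hölder functions *)

(* [norm] is the absolute value when [E] is [R], and the Euclidean norm
   when [E] is [R * R]. *)
Definition holder_on {E : NormedModule R_AbsRing} (alpha : R)
    (D : E -> Prop) (f : E -> R) : Prop :=
  exists K : R, forall p q : E, D p -> D q -> p <> q ->
    Rabs (f p - f q) <= K * Rpower (norm (minus p q)) alpha.

Definition periodic2pi (f : R -> R) : Prop :=
  forall x : R, f (x + 2 * PI) = f x.

Definition holder_periodic (p : nat) (alpha : R) (f : R -> R) : Prop :=
  periodic2pi f /\
  (forall i : nat, (i <= p)%nat -> forall x : R, ex_derive_n f i x) /\
  holder_on alpha (fun _ : R_NormedModule => True) (Derive_n f p).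

Definition mean (f : R -> R) : R := RInt f (- PI) PI / (2 * PI).

(** * The periodic Hilbert transform of the strip of depth [d] *)

Definition coth (x : R) : R := cosh x / sinh x.

Definition fourier_cos (w : R -> R) (n : nat) : R :=
  RInt (fun x => w x * cos (INR n * x)) (- PI) PI / PI.

Definition fourier_sin (w : R -> R) (n : nat) : R :=
  RInt (fun x => w x * sin (INR n * x)) (- PI) PI / PI.

(* The sum runs over the frequencies [n = S j >= 1], as an ordinary pointwise
   limit of partial sums.  It converges uniformly for [w] Hölder continuous and
   [2 * PI]-periodic.  The definition is total; it is the operator C_d when [w]
   moreover has zero mean. *)
Definition strip_hilbert (d : R) (w : R -> R) (x : R) : R :=
  Series (fun j : nat =>
    coth (INR (S j) * d) *
      (fourier_cos w (S j) * sin (INR (S j) * x)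
       - fourier_sin w (S j) * cos (INR (S j) * x))).

(** * Harmonic extension to the strip *)

Definition open_strip (d : R) (p : R * R) : Prop := - d < snd p < 0.

Definition closed_strip (d : R) (p : R * R) : Prop := - d <= snd p <= 0.

Definition dx (V : R * R -> R) (p : R * R) : R :=
  Derive (fun t => V (t, snd p)) (fst p).

Definition dy (V : R * R -> R) (p : R * R) : R :=
  Derive (fun t => V (fst p, t)) (snd p).

Definition C1_on (U : R * R -> Prop) (V : R * R -> R) : Prop :=
  forall p : R * R, U p ->
    ex_derive (fun t => V (t, snd p)) (fst p) /\
    ex_derive (fun t => V (fst p, t)) (snd p) /\
    continuous (dx V) p /\ continuous (dy V) p.

Definition harmonic_on (U : R * R -> Prop) (V : R * R -> R) : Prop :=
  C1_on U V /\ C1_on U (dx V) /\ C1_on U (dy V) /\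
  forall p : R * R, U p -> dx (dx V) p + dy (dy V) p = 0.

(* [V] is of class C^{1,alpha} up to the boundary of the strip: it is continuous
   on the closed strip, C^1 inside, and its gradient extends to an
   alpha-Hölder field [(Vx, Vy)] on the closed strip.  By density, [Vx] and [Vy]
   are determined on the closed strip by [V]; on the two boundary lines they are
   the boundary values of the partial derivatives. *)
Definition C1_holder_closed_strip (alpha d : R) (V Vx Vy : R * R -> R) : Prop :=
  continuous_on (closed_strip d) V /\
  C1_on (open_strip d) V /\
  (forall p : R * R, open_strip d p -> Vx p = dx V p /\ Vy p = dy V p) /\
  holder_on alpha (closed_strip d) Vx /\
  holder_on alpha (closed_strip d) Vy.

Definition harmonic_extension (alpha d : R) (v : R -> R)
    (V Vx Vy : R * R -> R) : Prop :=
  (forall x y : R, - d <= y <= 0 -> V (x + 2 * PI, y) = V (x, y)) /\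
  C1_holder_closed_strip alpha d V Vx Vy /\
  harmonic_on (open_strip d) V /\
  (forall x : R, V (x, 0) = v x) /\
  (forall x : R, V (x, - d) = 0).

(** * The equations *)

(* 1/k + C_{kh}(v'), the value at [y = 0] of the normal derivative of the
   harmonic extension of [v] when [mean v = h]. *)
Definition normal_der (k h : R) (v : R -> R) (x : R) : R :=
  1 / k + strip_hilbert (k * h) (Derive v) x.

Definition flux_term (k h Ups m : R) (v : R -> R) (x : R) : R :=
  m / (k * h) - Ups / (2 * (k * h)) * mean (fun t => v t ^ 2)
  - Ups * strip_hilbert (k * h) (fun t => v t * Derive v t) x.

Definition equation_E1 (g k h Ups m Q : R) (v : R -> R) : Prop :=
  forall x : R,
    strip_hilbert (k * h)
      (fun t => (Q - 2 * g * v t - Ups ^ 2 * v t ^ 2) * Derive v t) x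
    + (Q - 2 * g * v x - Ups ^ 2 * v x ^ 2) * normal_der k h v x
    - 2 * Ups * v x * flux_term k h Ups m v x
    - (Q - 2 * Ups * m - 2 * g * h) / k
    + 2 * g * mean (fun t => v t * strip_hilbert (k * h) (Derive v) t)
    = 0.

Definition equation_E2 (g k h Ups m Q : R) (v : R -> R) : Prop :=
  mean (fun x => (flux_term k h Ups m v x + Ups * v x * normal_der k h v x) ^ 2)
  - mean (fun x => (Q - 2 * g * v x) *
                     (Derive v x ^ 2 + normal_der k h v x ^ 2))
  = 0.

Definition equation_B (g k h Ups m Q : R) (v : R -> R) : Prop :=
  forall x : R,
    (flux_term k h Ups m v x + Ups * v x * normal_der k h v x) ^ 2
    - (Q - 2 * g * v x) * (Derive v x ^ 2 + normal_der k h v x ^ 2)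
    = 0.

(* Main.v *)
Require Import Defs.
From Stdlib Require Import Reals ZArith Lra Lia.
From Coquelicot Require Import Coquelicot.
Open Scope R_scope.

(** Write [d = k h], let [V] be the harmonic extension of [v], and let [G] be the
   holomorphic function in the strip of depth [d], real on the bottom, whose
   imaginary part on the top line is [- Ups v v'].  On the top line put
<<
   f = N + i v'                         N = normal_der, the value of V_y,
   G = F - i Ups v v'                   F = flux_term,
   P = (X N - 2 Ups v F) - i X v'       X = Q - 2 g v - Ups^2 v^2.
>>
   The functions [f = V_y + i V_x] and [G] are boundary values of holomorphic
   periodic functions which are real on the bottom line.  Such a boundary value is
   [c + C_d B + i B] for a constant [c], and conversely; so (E1) says that [P] is one
   too, up to the value of the constant, and this value is automatic: it is found by
   taking means and using the symmetry of [u |-> C_d u'].  The link with (B) is the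
   identity, valid on the top line,
<<
   G^2 - P f = (F + Ups v N)^2 - (Q - 2 g v) (v'^2 + N^2),
>>
   in which the right-hand side is real and is the left-hand side of (B).

   If (E1) holds, [G^2 - P f] is the boundary value of a holomorphic function which
   is real on both boundary lines, hence a constant, and (E2) says that its mean is
   zero.  Conversely, (B) gives [P = G^2 / f], and since [f] has no zero in the closed
   strip, [1 / f] is holomorphic and [P] is a boundary value, which is (E1); (E2) is
   the mean of (B).

   Boundary values are handled through their Fourier coefficients: the class
   [strip_boundary] consists of the pairs of continuous functions on the top line
   which satisfy the orthogonality relations that Cauchy's theorem imposes.  Members
   with uniformly convergent Fourier expansions multiply the class into itself
   ([multiplier]); this covers [f], [G] and [P] in the first half, because for a
   Hölder function both the Fourier series and the series defining [C_d] converge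
   uniformly ([holder_fourier_unif_cauchy], [hilbert_sum_lim]).  In the second half
   [1 / f] enters only as a member of the class, by Cauchy's theorem in the strip
   ([holomorphic_strip_boundary]), and is multiplied twice by [G]. *)

(** * Continuous functions and their integrals over a period *)

Definition cont (f : R -> R) : Prop := forall x, continuous f x.

Lemma cont_const (c : R) : cont (fun _ => c).
Proof. intros x; apply continuous_const. Qed.

Lemma cont_id : cont (fun x => x).
Proof. intros x; apply continuous_id. Qed.

Lemma cont_plus f g : cont f -> cont g -> cont (fun x => f x + g x).
Proof. intros Hf Hg x; apply (continuous_plus f g); auto. Qed.

Lemma cont_minus f g : cont f -> cont g -> cont (fun x => f x - g x).
Proof. intros Hf Hg x; apply (continuous_minus f g); auto. Qed.

Lemma cont_opp f : cont f -> cont (fun x => - f x).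
Proof. intros Hf x; apply (continuous_opp f); auto. Qed.

Lemma cont_mult f g : cont f -> cont g -> cont (fun x => f x * g x).
Proof. intros Hf Hg x; apply (continuous_mult f g); auto. Qed.

Lemma cont_pow f n : cont f -> cont (fun x => f x ^ n).
Proof.
  intros Hf; induction n as [|n IH]; simpl.
  - apply cont_const.
  - now apply cont_mult.
Qed.

Lemma cont_comp f g : cont f -> cont g -> cont (fun x => g (f x)).
Proof. intros Hf Hg x; apply continuous_comp; auto. Qed.

Lemma cont_cos f : cont f -> cont (fun x => cos (f x)).
Proof. intros Hf; apply (cont_comp f cos Hf); intro; apply continuous_cos. Qed.

Lemma cont_sin f : cont f -> cont (fun x => sin (f x)).
Proof. intros Hf; apply (cont_comp f sin Hf); intro; apply continuous_sin. Qed.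

Lemma cont_abs f : cont f -> cont (fun x => Rabs (f x)).
Proof. intros Hf; apply (cont_comp f Rabs Hf); intro; apply continuous_Rabs. Qed.

Lemma cont_ext f g : (forall x, f x = g x) -> cont f -> cont g.
Proof. intros E Hf x; now apply (continuous_ext f). Qed.

Lemma sum_Sn_R (u : nat -> R) n : sum_n u (S n) = sum_n u n + u (S n).
Proof. exact (sum_Sn u n). Qed.

Lemma cont_sum (f : nat -> R -> R) N :
  (forall n, cont (f n)) -> cont (fun x => sum_n (fun n => f n x) N).
Proof.
  intros Hf; induction N as [|N IH].
  - apply (cont_ext (f O)); auto; intro; now rewrite sum_O.
  - apply (cont_ext (fun x => sum_n (fun n => f n x) N + f (S N) x)).
    + intro; now rewrite sum_Sn_R.
    + now apply cont_plus.
Qed.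

Ltac cont :=
  repeat match goal with
  | H : cont ?f |- cont ?f => exact H
  | |- cont (fun _ => ?c) => apply cont_const
  | |- cont (fun x => x) => apply cont_id
  | |- cont cos => apply (cont_cos _ cont_id)
  | |- cont sin => apply (cont_sin _ cont_id)
  | |- cont (Rmult ?c) => apply (cont_mult (fun _ => c) (fun x => x))
  | |- cont (Rplus ?c) => apply (cont_plus (fun _ => c) (fun x => x))
  | |- cont (fun x => _ + _) => apply cont_plus
  | |- cont (fun x => _ - _) => apply cont_minus
  | |- cont (fun x => - _) => apply cont_opp
  | |- cont (fun x => _ * _) => apply cont_mult
  | |- cont (fun x => _ / _) => unfold Rdiv; apply cont_mult
  | |- cont (fun x => _ ^ _) => apply cont_pow
  | |- cont (fun x => cos _) => apply cont_cos
  | |- cont (fun x => sin _) => apply cont_sin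
  | |- cont (fun x => Rabs _) => apply cont_abs
  | H : cont ?f |- cont (fun x => ?f (@?g x)) => apply (cont_comp g f); [|exact H]
  end; auto.

(** [ring] does not recognise [R] in the carriers of the canonical structures on it. *)
Ltac eq_in_R := match goal with |- @eq _ ?a ?b => change (@eq R a b) end.

Lemma cont_eps f x e : cont f -> 0 < e ->
  exists d, 0 < d /\ forall y, Rabs (y - x) < d -> Rabs (f y - f x) < e.
Proof.
  intros Hf He.
  destruct (proj1 (filterlim_locally f (f x)) (Hf x) (mkposreal e He)) as [d Hd].
  exists d; split; [apply cond_pos|]. intros y Hy; now apply Hd.
Qed.

Lemma cont_of_eps (f : R -> R) :
  (forall x e, 0 < e -> exists d, 0 < d /\
     forall y, Rabs (y - x) < d -> Rabs (f y - f x) < e) -> cont f.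
Proof.
  intros H x. apply filterlim_locally; intros e.
  destruct (H x e (cond_pos e)) as [d [Hd H']].
  exists (mkposreal d Hd); intros y Hy; now apply H'.
Qed.

Lemma cont_ex_RInt f a b : cont f -> ex_RInt f a b.
Proof. intros Hf; apply (ex_RInt_continuous f); auto. Qed.

Lemma cont_bounded_on f a b : a <= b -> cont f ->
  exists M, 0 <= M /\ forall x, a <= x <= b -> Rabs (f x) <= M.
Proof.
  intros Hab Hf.
  destruct (continuity_ab_maj (fun x => Rabs (f x)) a b Hab) as [z [Hz _]].
  - intros c _; apply continuity_pt_filterlim; apply (cont_abs f Hf).
  - exists (Rabs (f z)); split; [apply Rabs_pos|auto].
Qed.

Lemma RInt_lincomb f g a b c d : cont f -> cont g ->
  RInt (fun x => c * f x + d * g x) a b = c * RInt f a b + d * RInt g a b.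
Proof.
  intros Hf Hg.
  rewrite (RInt_plus (fun x => c * f x) (fun x => d * g x)).
  - rewrite (RInt_scal f), (RInt_scal g); auto using cont_ex_RInt.
  - apply cont_ex_RInt; cont.
  - apply cont_ex_RInt; cont.
Qed.

Lemma RInt_abs_le f g a b : a <= b -> cont f -> cont g ->
  (forall x, a <= x <= b -> Rabs (f x) <= g x) -> Rabs (RInt f a b) <= RInt g a b.
Proof.
  intros Hab Hf Hg H.
  apply (norm_RInt_le f g a b); auto.
  - apply (RInt_correct f), cont_ex_RInt; auto.
  - apply (RInt_correct g), cont_ex_RInt; auto.
Qed.

Definition period_int (f : R -> R) : R := RInt f (- PI) PI.

Lemma period_int_ext f g : (forall x, f x = g x) -> period_int f = period_int g.
Proof. intros E; apply RInt_ext; auto. Qed.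

Lemma period_int_lincomb f g h c d : cont f -> cont g ->
  (forall x, h x = c * f x + d * g x) -> period_int h = c * period_int f + d * period_int g.
Proof.
  intros Hf Hg E; rewrite (period_int_ext _ _ E); now apply RInt_lincomb.
Qed.

Lemma period_int_scal f h c : cont f -> (forall x, h x = c * f x) -> period_int h = c * period_int f.
Proof.
  intros Hf E. rewrite (period_int_lincomb f f h c 0); auto; [ring|intro; rewrite E; ring].
Qed.

Lemma period_int_plus f g : cont f -> cont g -> period_int (fun x => f x + g x) = period_int f + period_int g.
Proof.
  intros Hf Hg; rewrite (period_int_lincomb f g _ 1 1); auto; [ring|intro; ring].
Qed.

Lemma period_int_minus f g : cont f -> cont g -> period_int (fun x => f x - g x) = period_int f - period_int g.
Proof.
  intros Hf Hg; rewrite (period_int_lincomb f g _ 1 (-1)); auto; [ring|intro; ring].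
Qed.

Lemma period_int_const c : period_int (fun _ => c) = 2 * PI * c.
Proof. unfold period_int; rewrite RInt_const; unfold scal; simpl; unfold mult; simpl; ring. Qed.

Lemma period_int_sum (f : nat -> R -> R) N : (forall n, cont (f n)) ->
  period_int (fun x => sum_n (fun n => f n x) N) = sum_n (fun n => period_int (f n)) N.
Proof.
  intros Hf; induction N as [|N IH].
  - rewrite sum_O; apply period_int_ext; intro; now rewrite sum_O.
  - rewrite sum_Sn_R, <- IH.
    rewrite <- (period_int_plus (fun x => sum_n (fun n => f n x) N)); auto using cont_sum.
    apply period_int_ext; intro; now rewrite sum_Sn_R.
Qed.

Lemma period_int_derive f g : (forall x, is_derive f x (g x)) -> cont g ->
  f (- PI) = f PI -> period_int g = 0.
Proof.
  intros Hd Hg E. unfold period_int.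
  rewrite (is_RInt_unique _ _ _ _ (is_RInt_derive f g (-PI) PI (fun x _ => Hd x) (fun x _ => Hg x))).
  rewrite E. apply (minus_eq_zero (f PI)).
Qed.

Lemma period_int_bound f M : cont f -> (forall x, Rabs (f x) <= M) ->
  Rabs (period_int f) <= 2 * PI * M.
Proof.
  intros Hf H. pose proof PI_RGT_0.
  rewrite <- (period_int_const M).
  apply RInt_abs_le; cont; lra.
Qed.

Lemma sin_mul_PI n : sin (IZR n * PI) = 0.
Proof. apply sin_eq_0_1; now exists n. Qed.

Lemma period_int_cos_Z n : n <> Z0 -> period_int (fun x => cos (IZR n * x)) = 0.
Proof.
  intros Hn. assert (IZR n <> 0) by (now apply not_0_IZR).
  apply (period_int_derive (fun x => sin (IZR n * x) / IZR n)).
  - intros x; auto_derive; auto; field; auto.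
  - cont.
  - cbv beta; rewrite Ropp_mult_distr_r_reverse, sin_neg, sin_mul_PI, Ropp_0; reflexivity.
Qed.

Lemma cos_mul_PI_even n : cos (IZR n * - PI) = cos (IZR n * PI).
Proof. rewrite <- (cos_neg (IZR n * PI)); f_equal; ring. Qed.

Lemma period_int_sin_Z n : period_int (fun x => sin (IZR n * x)) = 0.
Proof.
  destruct (Z.eq_dec n 0) as [->|Hn].
  - rewrite (period_int_ext _ (fun _ => 0)); [rewrite period_int_const; ring|].
    intro; rewrite Rmult_0_l; apply sin_0.
  - assert (IZR n <> 0) by (now apply not_0_IZR).
    apply (period_int_derive (fun x => - cos (IZR n * x) / IZR n)).
    + intros x; auto_derive; auto; field; auto.
    + cont.
    + cbv beta; now rewrite cos_mul_PI_even.
Qed.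

Definition unif_lim (fn : nat -> R -> R) (f : R -> R) : Prop :=
  forall e, 0 < e -> exists N, forall n, (N <= n)%nat -> forall x, Rabs (fn n x - f x) <= e.

Lemma unif_lim_cont fn f : (forall n, cont (fn n)) -> unif_lim fn f -> cont f.
Proof.
  intros Hn Hl; apply cont_of_eps; intros x e He.
  destruct (Hl (e / 4)) as [N HN]; [lra|].
  destruct (cont_eps (fn N) x (e / 4) (Hn N)) as [d [Hd H]]; [lra|].
  exists d; split; auto; intros y Hy.
  specialize (H y Hy). pose proof (HN N (le_n _) x). pose proof (HN N (le_n _) y).
  apply Rabs_def2 in H. apply Rabs_le_between in H0, H1. apply Rabs_def1; lra.
Qed.

Lemma unif_lim_period_int fn f g : (forall n, cont (fn n)) -> cont f -> cont g ->
  unif_lim fn f ->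
  is_lim_seq (fun n => period_int (fun x => fn n x * g x)) (period_int (fun x => f x * g x)).
Proof.
  intros Hn Hf Hg Hl. pose proof PI_RGT_0.
  destruct (cont_bounded_on g (- PI) PI) as [M [HM Hb]]; [lra|auto|].
  apply is_lim_seq_spec; intros e.
  assert (HP : 0 < 2 * PI * (M + 1)) by nra.
  destruct (Hl (e / (2 * (2 * PI * (M + 1))))) as [N HN].
  { apply Rdiv_lt_0_compat; [apply cond_pos|nra]. }
  exists N; intros n Hnn.
  rewrite <- (period_int_minus (fun x => fn n x * g x)); cont.
  apply Rle_lt_trans with (period_int (fun _ => e / (2 * (2 * PI * (M + 1))) * M)).
  - apply RInt_abs_le; cont; [lra|]. intros x Hx.
    rewrite <- Rmult_minus_distr_r, Rabs_mult.
    apply Rmult_le_compat; auto using Rabs_pos.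
  - rewrite period_int_const. apply Rlt_trans with (2 * PI * (e / (2 * (2 * PI * (M + 1))) * (M + 1))).
    + apply Rmult_lt_compat_l; [lra|]. apply Rmult_lt_compat_l; [|lra].
      apply Rdiv_lt_0_compat; [apply cond_pos|nra].
    + pose proof (cond_pos e).
      replace (2 * PI * (e / (2 * (2 * PI * (M + 1))) * (M + 1))) with (e / 2); [lra|].
      field; lra.
Qed.

(** The shape in which orthogonality relations between pairs of functions pass to
   uniform limits. *)
Lemma unif_lim_period_int_zero2 fn1 f1 g1 fn2 f2 g2 :
  (forall n, cont (fn1 n)) -> cont g1 -> unif_lim fn1 f1 ->
  (forall n, cont (fn2 n)) -> cont g2 -> unif_lim fn2 f2 ->
  (forall n, period_int (fun x => fn1 n x * g1 x + fn2 n x * g2 x) = 0) ->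
  period_int (fun x => f1 x * g1 x + f2 x * g2 x) = 0.
Proof.
  intros Hn1 Hg1 Hl1 Hn2 Hg2 Hl2 H.
  assert (Hf1 : cont f1) by (now apply (unif_lim_cont fn1)).
  assert (Hf2 : cont f2) by (now apply (unif_lim_cont fn2)).
  assert (L := is_lim_seq_plus' _ _ _ _ (unif_lim_period_int fn1 f1 g1 Hn1 Hf1 Hg1 Hl1)
                 (unif_lim_period_int fn2 f2 g2 Hn2 Hf2 Hg2 Hl2)).
  apply is_lim_seq_ext with (v := fun _ => 0) in L.
  - apply is_lim_seq_unique in L. rewrite Lim_seq_const in L.
    rewrite period_int_plus; cont. injection L; auto.
  - intros n. rewrite <- (period_int_plus (fun x => fn1 n x * g1 x)); cont.
Qed.

(** * Periodic functions *)

Lemma periodic_iter f (n : nat) x : periodic2pi f -> f (x + 2 * INR n * PI) = f x.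
Proof.
  intros Hp; induction n as [|n IH].
  - f_equal; simpl; ring.
  - rewrite S_INR, <- IH, <- (Hp (x + 2 * INR n * PI)). f_equal; ring.
Qed.

Lemma periodic_reduce f : periodic2pi f ->
  forall x, exists y, - PI <= y <= PI /\ f y = f x.
Proof.
  intros Hp x. pose proof PI_RGT_0.
  destruct (euclidian_division (x + PI) (2 * PI)) as [k [r [E [Hr1 Hr2]]]]; [lra|].
  rewrite Rabs_right in Hr2 by lra.
  exists (r - PI); split; [lra|].
  destruct (Z_lt_le_dec k 0) as [Hk|Hk].
  - rewrite <- (periodic_iter f (Z.to_nat (- k)) x Hp). f_equal.
    rewrite INR_IZR_INZ, Z2Nat.id, opp_IZR by lia. lra.
  - rewrite <- (periodic_iter f (Z.to_nat k) (r - PI) Hp). f_equal.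
    rewrite INR_IZR_INZ, Z2Nat.id by lia. lra.
Qed.

Lemma periodic_bounded f : periodic2pi f -> cont f ->
  exists M, 0 <= M /\ forall x, Rabs (f x) <= M.
Proof.
  intros Hp Hf. pose proof PI_RGT_0.
  destruct (cont_bounded_on f (- PI) PI) as [M [HM Hb]]; [lra|auto|].
  exists M; split; auto; intros x.
  destruct (periodic_reduce f Hp x) as [y [Hy <-]]; auto.
Qed.

Lemma RInt_shift f x a b : cont f ->
  RInt (fun t => f (x + t)) a b = RInt f (x + a) (x + b).
Proof.
  intros Hf.
  assert (H := RInt_comp_lin f 1 x a b (cont_ex_RInt _ _ _ Hf)).
  rewrite <- (RInt_ext (fun t => f (x + t))) in H.
  - rewrite H; f_equal; ring.
  - intros; unfold scal; simpl; unfold mult; simpl. rewrite !Rmult_1_l; f_equal; ring.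
Qed.

(** Both sides differ by integrals of [f] over two intervals which are translates of
   each other by [2 * PI]. *)
Lemma period_int_shift f x : periodic2pi f -> cont f -> period_int (fun t => f (x + t)) = period_int f.
Proof.
  intros Hp Hf. unfold period_int.
  assert (Hex : forall a b, ex_RInt f a b) by (intros; now apply cont_ex_RInt).
  rewrite RInt_shift by auto.
  assert (E : RInt f PI (x + PI) = RInt f (- PI) (x + - PI)).
  { rewrite <- (RInt_ext (fun t => f (2 * PI + t)) f (- PI) (x + - PI)).
    - rewrite RInt_shift by auto. f_equal; ring.
    - intros t _; rewrite <- (Hp t); f_equal; ring. }
  assert (C1 := RInt_Chasles f (- PI) (x + - PI) (x + PI) (Hex _ _) (Hex _ _)).
  assert (C2 := RInt_Chasles f (- PI) PI (x + PI) (Hex _ _) (Hex _ _)).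
  unfold plus in C1, C2; simpl in C1, C2. rewrite E in C2. lra.
Qed.

(** * Uniqueness of Fourier coefficients *)

Lemma cos_moments_mult f c : cont f ->
  (forall n, period_int (fun t => f t * cos (INR n * t)) = 0) ->
  forall n, period_int (fun t => f t * (c + cos t) * cos (INR n * t)) = 0.
Proof.
  intros Hf H n. destruct n as [|m].
  - rewrite (period_int_lincomb (fun t => f t * cos (INR 0 * t)) (fun t => f t * cos (INR 1 * t)) _ c 1);
      cont.
    + rewrite !H; ring.
    + intro t; change (INR 0) with 0; change (INR 1) with 1.
      rewrite Rmult_0_l, cos_0, (Rmult_1_l t); ring.
  - rewrite (period_int_lincomb (fun t => f t * cos (INR (S m) * t))
      (fun t => f t * cos (INR (S (S m)) * t) + f t * cos (INR m * t)) _ c (1/2)); cont.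
    + rewrite period_int_plus by cont. rewrite !H; ring.
    + intro t. rewrite !S_INR.
      replace ((INR m + 1 + 1) * t) with ((INR m + 1) * t + t) by ring.
      replace (INR m * t) with ((INR m + 1) * t - t) by ring.
      rewrite cos_plus, cos_minus; field.
Qed.

Lemma cos_moments_pow f c N : cont f ->
  (forall n, period_int (fun t => f t * cos (INR n * t)) = 0) ->
  period_int (fun t => f t * (c + cos t) ^ N) = 0.
Proof.
  intros Hf H.
  assert (K : forall n, period_int (fun t => f t * (c + cos t) ^ N * cos (INR n * t)) = 0).
  { induction N as [|N IH].
    - intros n; rewrite <- (H n); apply period_int_ext; intro; simpl; ring.
    - intros n.
      rewrite <- (cos_moments_mult (fun t => f t * (c + cos t) ^ N) c ltac:(cont) IH n).
      apply period_int_ext; intro; simpl; ring. }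
  rewrite <- (K O); apply period_int_ext; intro; simpl; rewrite Rmult_0_l, cos_0; ring.
Qed.

(** Suppose [f 0 > 0].  The powers of [1 - cos d + cos t] are polynomials in [cos t], so
   the integral of [f] against each of them vanishes.  But they are at most [1] in absolute
   value outside [[-d, d]], they are nonnegative on that interval, where [f] is
   positive when [d] is small, and they grow geometrically on [[-d / 2, d / 2]]. *)
Lemma cos_moments_nonpos f : cont f ->
  (forall n, period_int (fun t => f t * cos (INR n * t)) = 0) -> f 0 <= 0.
Proof.
  intros Hf H. apply Rnot_lt_le; intros Hpos. pose proof PI_RGT_0 as HPI.
  destruct (cont_eps f 0 (f 0 / 2) Hf) as [d0 [Hd0 Hnear0]]; [lra|].
  pose (d := Rmin (d0 / 2) (PI / 2)).
  assert (Hd : 0 < d) by (apply Rmin_glb_lt; lra).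
  assert (Hd1 : d <= d0 / 2) by apply Rmin_l.
  assert (Hd2 : d <= PI / 2) by apply Rmin_r.
  assert (Hnear : forall t, - d <= t <= d -> f 0 / 2 <= f t).
  { intros t Ht. specialize (Hnear0 t). rewrite Rminus_0_r in Hnear0.
    assert (Ha : Rabs t < d0) by (apply Rabs_def1; lra).
    apply Hnear0, Rabs_def2 in Ha. lra. }
  clearbody d; clear d0 Hd0 Hnear0 Hd1.
  destruct (cont_bounded_on f (- PI) PI) as [M [HM Hb]]; [lra|auto|].
  pose (c := 1 - cos d). pose (rho := c + cos (d / 2)).
  assert (Hrho : 1 < rho).
  { unfold rho, c. assert (cos d < cos (d / 2)) by (apply cos_decreasing_1; lra). lra. }
  assert (Hc0 : 0 <= cos d) by (apply cos_ge_0; lra).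
  assert (Hcabs : forall t, cos (Rabs t) = cos t).
  { intro t; unfold Rabs; destruct (Rcase_abs t); auto; apply cos_neg. }
  assert (Hlarge : forall t N, - (d / 2) <= t <= d / 2 -> f 0 / 2 * rho ^ N <= f t * (c + cos t) ^ N).
  { intros t N Ht. assert (f 0 / 2 <= f t) by (apply Hnear; lra).
    assert (Ha : Rabs t <= d / 2) by (apply Rabs_le; lra). pose proof (Rabs_pos t).
    assert (cos (d / 2) <= cos (Rabs t)) by (apply cos_decr_1; lra).
    rewrite Hcabs in *. apply Rmult_le_compat; try lra.
    - apply pow_le; lra.
    - apply pow_incr; unfold rho in *; lra. }
  assert (Hsmall : forall t N, - PI <= t <= PI -> - M <= f t * (c + cos t) ^ N).
  { intros t N Ht. pose proof (Rabs_pos t).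
    assert (Ha : Rabs t <= PI) by (apply Rabs_le; lra).
    destruct (Rle_dec (Rabs t) d) as [Hle|Hgt].
    - assert (f 0 / 2 <= f t) by (apply Hnear; apply Rabs_le_between; auto).
      assert (cos d <= cos (Rabs t)) by (apply cos_decr_1; lra).
      rewrite Hcabs in *.
      assert (0 <= (c + cos t) ^ N) by (apply pow_le; unfold c; lra). nra.
    - assert (cos (Rabs t) <= cos d) by (apply cos_decr_1; lra).
      rewrite Hcabs in *. pose proof (COS_bound t); pose proof (COS_bound d).
      assert (Hp : Rabs ((c + cos t) ^ N) <= 1).
      { rewrite <- RPow_abs. rewrite <- (pow1 N). apply pow_incr; split; [apply Rabs_pos|].
        apply Rabs_le; unfold c; lra. }
      assert (Hft : Rabs (f t * (c + cos t) ^ N) <= M * 1).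
      { rewrite Rabs_mult; apply Rmult_le_compat; auto using Rabs_pos. }
      apply Rabs_le_between in Hft; lra. }
  assert (Hlow : forall N, d * (f 0 / 2 * rho ^ N) - 2 * PI * M <= 0).
  { intros N. assert (E := cos_moments_pow f c N Hf H). unfold period_int in E.
    set (F := fun t => f t * (c + cos t) ^ N) in E.
    assert (HF : cont F) by (unfold F; cont).
    assert (Hex : forall a b, ex_RInt F a b) by (intros; now apply cont_ex_RInt).
    rewrite <- (RInt_Chasles F (- PI) (- (d / 2)) PI) in E by auto.
    rewrite <- (RInt_Chasles F (- (d / 2)) (d / 2) PI) in E by auto.
    unfold plus in E; simpl in E.
    assert (B1 : (- (d / 2) - - PI) * (- M) <= RInt F (- PI) (- (d / 2))).
    { replace ((- (d / 2) - - PI) * - M) with (RInt (fun _ => - M) (- PI) (- (d / 2))).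
      - apply RInt_le; auto; [lra|apply ex_RInt_const|]. intros; apply Hsmall; lra.
      - rewrite RInt_const; reflexivity. }
    assert (B3 : (PI - d / 2) * (- M) <= RInt F (d / 2) PI).
    { replace ((PI - d / 2) * - M) with (RInt (fun _ => - M) (d / 2) PI).
      - apply RInt_le; auto; [lra|apply ex_RInt_const|]. intros; apply Hsmall; lra.
      - rewrite RInt_const; reflexivity. }
    assert (B2 : (d / 2 - - (d / 2)) * (f 0 / 2 * rho ^ N) <= RInt F (- (d / 2)) (d / 2)).
    { replace ((d / 2 - - (d / 2)) * (f 0 / 2 * rho ^ N))
        with (RInt (fun _ => f 0 / 2 * rho ^ N) (- (d / 2)) (d / 2)).
      - apply RInt_le; auto; [lra|apply ex_RInt_const|]. intros; apply Hlarge; lra.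
      - rewrite RInt_const; reflexivity. }
    assert (0 <= d * M) by nra. nra. }
  destruct (Pow_x_infinity rho) with (b := (2 * PI * M + 1) / (d * (f 0 / 2))) as [N HN].
  { rewrite Rabs_right; lra. }
  specialize (HN N (le_n _)). specialize (Hlow N).
  rewrite Rabs_right in HN by (apply Rle_ge, pow_le; lra).
  assert (Hq : 0 < d * (f 0 / 2)) by nra.
  apply Rge_le, (Rmult_le_compat_l (d * (f 0 / 2))) in HN; [|lra].
  replace (d * (f 0 / 2) * ((2 * PI * M + 1) / (d * (f 0 / 2)))) with (2 * PI * M + 1) in HN
    by (field; lra). lra.
Qed.

Lemma periodic_mult f g : periodic2pi f -> periodic2pi g -> periodic2pi (fun x => f x * g x).
Proof. intros Hf Hg x; now rewrite Hf, Hg. Qed.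

Lemma periodic_cos n c : periodic2pi (fun x => cos (INR n * x + c)).
Proof.
  intros x. replace (INR n * (x + 2 * PI) + c) with (INR n * x + c + 2 * INR n * PI) by ring.
  apply cos_period.
Qed.

(** The cosine moments of every translate of [w] and of [- w] vanish as well, so the
   preceding lemma applies at every point. *)
Lemma fourier_unique w : periodic2pi w -> cont w ->
  (forall n, period_int (fun t => w t * cos (INR n * t)) = 0) ->
  (forall n, period_int (fun t => w t * sin (INR n * t)) = 0) -> forall x, w x = 0.
Proof.
  intros Hp Hw Hc Hs.
  assert (K : forall x n, period_int (fun t => w (x + t) * cos (INR n * t)) = 0).
  { intros x n.
    rewrite (period_int_ext _ (fun t => w (x + t) * cos (INR n * (x + t) + - (INR n * x)))).
    2:{ intro t; do 2 f_equal; ring. }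
    rewrite (period_int_shift (fun s => w s * cos (INR n * s + - (INR n * x)))); cont.
    2:{ apply periodic_mult; auto using periodic_cos. }
    rewrite (period_int_lincomb (fun t => w t * cos (INR n * t)) (fun t => w t * sin (INR n * t)) _
               (cos (INR n * x)) (sin (INR n * x))); cont.
    - rewrite Hc, Hs; ring.
    - intro t; rewrite cos_plus, cos_neg, sin_neg; ring. }
  intros x; apply Rle_antisym.
  - replace (w x) with (w (x + 0)) by (f_equal; ring).
    apply (cos_moments_nonpos (fun t => w (x + t))); cont.
  - cut (- w x <= 0); [lra|].
    replace (w x) with (w (x + 0)) by (f_equal; ring).
    apply (cos_moments_nonpos (fun t => - w (x + t))); cont.
    intros n. rewrite (period_int_scal (fun t => w (x + t) * cos (INR n * t)) _ (-1)); cont.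
    + rewrite K; ring.
    + intro; ring.
Qed.

(** * Fourier coefficients *)

Lemma fourier_cos_bound w M n : cont w -> (forall x, Rabs (w x) <= M) ->
  Rabs (fourier_cos w n) <= 2 * M.
Proof.
  intros Hw HM. pose proof PI_RGT_0. unfold fourier_cos.
  fold (period_int (fun x => w x * cos (INR n * x))).
  assert (Rabs (period_int (fun x => w x * cos (INR n * x))) <= 2 * PI * M).
  { apply period_int_bound; cont. intro x; rewrite Rabs_mult, <- (Rmult_1_r M).
    apply Rmult_le_compat; auto using Rabs_pos. apply Rabs_le, COS_bound. }
  rewrite Rabs_div, (Rabs_right PI) by lra.
  apply Rle_div_l; lra.
Qed.

Lemma fourier_sin_bound w M n : cont w -> (forall x, Rabs (w x) <= M) ->
  Rabs (fourier_sin w n) <= 2 * M.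
Proof.
  intros Hw HM. pose proof PI_RGT_0. unfold fourier_sin.
  fold (period_int (fun x => w x * sin (INR n * x))).
  assert (Rabs (period_int (fun x => w x * sin (INR n * x))) <= 2 * PI * M).
  { apply period_int_bound; cont. intro x; rewrite Rabs_mult, <- (Rmult_1_r M).
    apply Rmult_le_compat; auto using Rabs_pos. apply Rabs_le, SIN_bound. }
  rewrite Rabs_div, (Rabs_right PI) by lra.
  apply Rle_div_l; lra.
Qed.

Lemma is_derive_cont (f g : R -> R) : (forall x, is_derive f x (g x)) -> cont f.
Proof. intros H x; apply (ex_derive_continuous f). now exists (g x). Qed.

Lemma periodic_ends f : periodic2pi f -> f (- PI) = f PI.
Proof. intros Hp; rewrite <- Hp; f_equal; ring. Qed.

Lemma fourier_cos_derive (f g : R -> R) n : periodic2pi f -> (forall x, is_derive f x (g x)) -> cont g ->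
  fourier_cos g n = INR n * fourier_sin f n.
Proof.
  intros Hp Hd Hg. pose proof PI_RGT_0. assert (Hf := is_derive_cont f g Hd).
  unfold fourier_cos, fourier_sin.
  fold (period_int (fun x => g x * cos (INR n * x))). fold (period_int (fun x => f x * sin (INR n * x))).
  assert (E : period_int (fun x => 1 * (g x * cos (INR n * x)) + - INR n * (f x * sin (INR n * x))) = 0).
  { apply (period_int_derive (fun x => f x * cos (INR n * x))); cont.
    - intro x. auto_derive; [now exists (g x)|].
      replace (Derive (fun y : R => f y) x) with (g x) by (symmetry; apply is_derive_unique, Hd); ring.
    - rewrite (periodic_ends f Hp), !INR_IZR_INZ, cos_mul_PI_even; auto. }
  unfold period_int in E at 1. rewrite RInt_lincomb in E by cont.
  fold (period_int (fun x => g x * cos (INR n * x))) in E. fold (period_int (fun x => f x * sin (INR n * x))) in E.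
  replace (period_int (fun x => g x * cos (INR n * x))) with (INR n * period_int (fun x => f x * sin (INR n * x)))
    by lra. field; lra.
Qed.

Lemma fourier_sin_derive (f g : R -> R) n : periodic2pi f -> (forall x, is_derive f x (g x)) -> cont g ->
  fourier_sin g n = - INR n * fourier_cos f n.
Proof.
  intros Hp Hd Hg. pose proof PI_RGT_0. assert (Hf := is_derive_cont f g Hd).
  unfold fourier_cos, fourier_sin.
  fold (period_int (fun x => g x * sin (INR n * x))). fold (period_int (fun x => f x * cos (INR n * x))).
  assert (E : period_int (fun x => 1 * (g x * sin (INR n * x)) + INR n * (f x * cos (INR n * x))) = 0).
  { apply (period_int_derive (fun x => f x * sin (INR n * x))); cont.
    - intro x. auto_derive; [now exists (g x)|].
      replace (Derive (fun y : R => f y) x) with (g x) by (symmetry; apply is_derive_unique, Hd); ring.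
    - rewrite (periodic_ends f Hp), Ropp_mult_distr_r_reverse, sin_neg, !INR_IZR_INZ, sin_mul_PI.
      rewrite Ropp_0, !Rmult_0_r; reflexivity. }
  unfold period_int in E at 1. rewrite RInt_lincomb in E by cont.
  fold (period_int (fun x => g x * sin (INR n * x))) in E. fold (period_int (fun x => f x * cos (INR n * x))) in E.
  replace (period_int (fun x => g x * sin (INR n * x))) with (- INR n * period_int (fun x => f x * cos (INR n * x)))
    by lra. field; lra.
Qed.

(** * Uniformly Cauchy sequences of functions *)

Definition unif_cauchy (fn : nat -> R -> R) : Prop :=
  forall e, 0 < e -> exists N, forall m n, (N <= m)%nat -> (N <= n)%nat ->
    forall x, Rabs (fn m x - fn n x) <= e.

(** The limit is written as in the definition of [Series]. *)
Lemma unif_cauchy_lim fn : unif_cauchy fn ->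
  unif_lim fn (fun x => real (Lim_seq (fun n => fn n x))).
Proof.
  intros H e He. destruct (H e He) as [N HN]. exists N; intros n Hn x.
  assert (Hex : ex_finite_lim_seq (fun n => fn n x)).
  { apply ex_lim_seq_cauchy_corr. intros e'.
    destruct (H (e' / 2)) as [N' HN']; [pose proof (cond_pos e'); lra|].
    exists N'; intros p q Hp Hq. specialize (HN' p q Hp Hq x).
    pose proof (cond_pos e'); lra. }
  apply Lim_seq_correct' in Hex.
  assert (Hc : is_lim_seq (fun m => Rabs (fn n x - fn m x))
                 (Rabs (fn n x - real (Lim_seq (fun n => fn n x))))).
  { apply (is_lim_seq_abs _ (Finite _)). apply is_lim_seq_minus'; auto. apply is_lim_seq_const. }
  apply (is_lim_seq_le_loc _ (fun _ => e) _ (Finite e)) in Hc; [exact Hc| |apply is_lim_seq_const].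
  exists N; intros m Hm; now apply HN.
Qed.

Lemma unif_cauchy_plus fn gn : unif_cauchy fn -> unif_cauchy gn ->
  unif_cauchy (fun n x => fn n x + gn n x).
Proof.
  intros Hf Hg e He.
  destruct (Hf (e / 2)) as [N1 H1]; [lra|]. destruct (Hg (e / 2)) as [N2 H2]; [lra|].
  exists (max N1 N2); intros m n Hm Hn x.
  specialize (H1 m n ltac:(lia) ltac:(lia) x). specialize (H2 m n ltac:(lia) ltac:(lia) x).
  apply Rabs_le_between in H1, H2. apply Rabs_le; lra.
Qed.

Lemma unif_cauchy_ext fn gn : (forall n x, fn n x = gn n x) -> unif_cauchy fn -> unif_cauchy gn.
Proof.
  intros E H e He; destruct (H e He) as [N HN]; exists N; intros; rewrite <- !E; auto.
Qed.

Lemma sum_n_diff_le (u : nat -> R) a m n : (forall j, Rabs (u j) <= a j) -> (m <= n)%nat ->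
  Rabs (sum_n u n - sum_n u m) <= sum_n a n - sum_n a m.
Proof.
  intros H Hmn; induction Hmn as [|n Hmn IH].
  - rewrite !Rminus_diag, Rabs_R0; lra.
  - rewrite !sum_Sn_R.
    replace (sum_n u n + u (S n) - sum_n u m) with ((sum_n u n - sum_n u m) + u (S n)) by ring.
    eapply Rle_trans; [apply Rabs_triang|]. specialize (H (S n)); lra.
Qed.

(** Weierstrass' criterion. *)
Lemma unif_cauchy_dominated (u : nat -> R -> R) a :
  (forall j x, Rabs (u j x) <= a j) -> ex_series a ->
  unif_cauchy (fun n x => sum_n (fun j => u j x) n).
Proof.
  intros H [l Hl] e He.
  assert (Hc : ex_lim_seq_cauchy (sum_n a)) by (apply ex_lim_seq_cauchy_corr; now exists l).
  destruct (Hc (mkposreal e He)) as [N HN]; simpl in HN.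
  assert (K : forall m n, (N <= m)%nat -> (m <= n)%nat ->
            forall x, Rabs (sum_n (fun j => u j x) n - sum_n (fun j => u j x) m) <= e).
  { intros m n Hm Hn x.
    apply Rle_trans with (sum_n a n - sum_n a m).
    - apply (sum_n_diff_le (fun j => u j x)); auto.
    - specialize (HN n m ltac:(lia) ltac:(lia)). apply Rabs_def2 in HN; lra. }
  exists N; intros m n Hm Hn x.
  destruct (Nat.le_ge_cases m n).
  - rewrite Rabs_minus_sym; now apply K.
  - now apply K.
Qed.

Lemma ex_series_inv_sq : ex_series (fun j => / INR (S j) ^ 2).
Proof.
  (* the majorant telescopes, since [n + 1 <= 2 n] *)
  apply (ex_series_le (V := R_CompleteNormedModule) _ (fun j => 2 * (/ INR (S j) - / INR (S (S j))))).
  - intros j. assert (0 < INR (S j)) by (apply lt_0_INR; lia).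
    rewrite (S_INR (S j)). set (a := INR (S j)) in *.
    assert (1 <= a) by (unfold a; rewrite S_INR; pose proof (pos_INR j); lra).
    unfold norm; simpl; unfold abs; simpl. rewrite Rabs_right.
    + replace (2 * (/ a - / (a + 1))) with (/ (a * (a * 1)) + (a - 1) / (a * a * (a + 1)))
        by (field; lra).
      assert (0 <= (a - 1) / (a * a * (a + 1))); [|lra].
      apply Rdiv_le_0_compat; [lra|nra].
    + apply Rle_ge, Rlt_le, Rinv_0_lt_compat; nra.
  - exists 2.
    assert (E : forall n, sum_n (fun j => 2 * (/ INR (S j) - / INR (S (S j)))) n
                          = 2 - 2 * / INR (S (S n))).
    { induction n as [|n IH].
      - rewrite sum_O; simpl; field.
      - rewrite (sum_Sn_R (fun j => 2 * (/ INR (S j) - / INR (S (S j))))), IH; lra. }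
    change (is_lim_seq (sum_n (fun j => 2 * (/ INR (S j) - / INR (S (S j))))) 2).
    apply (is_lim_seq_ext (fun n => 2 - 2 * / INR (S (S n)))); [intro; now rewrite E|].
    replace (Finite 2) with (Finite (2 - 2 * 0)) by (f_equal; ring).
    apply is_lim_seq_minus'; [apply is_lim_seq_const|].
    apply (is_lim_seq_scal_l _ 2 (Finite 0)).
    apply (is_lim_seq_inv _ p_infty).
    + apply (is_lim_seq_ext (fun n => INR (n + 2))); [intro; f_equal; lia|].
      apply (is_lim_seq_incr_n INR 2), is_lim_seq_INR.
    + discriminate.
Qed.

(** * The partial sums as convolutions *)

(** The phase [theta = 0] gives the Fourier series of [w] and [theta = - PI / 2]
   the conjugate series. *)
Definition fourier_term (theta : R) (w : R -> R) (n : nat) (x : R) : R :=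
  fourier_cos w n * cos (INR n * x + theta) + fourier_sin w n * sin (INR n * x + theta).

Definition dirichlet (theta : R) (N : nat) (t : R) : R :=
  sum_n (fun j => cos (INR (S j) * t - theta)) N.

Lemma fourier_term_conv theta w n x : periodic2pi w -> cont w ->
  fourier_term theta w n x = period_int (fun t => w (x + t) * cos (INR n * t - theta)) / PI.
Proof.
  intros Hp Hw. pose proof PI_RGT_0.
  rewrite (period_int_ext _ (fun t => w (x + t) * cos (INR n * (x + t) + (- (INR n * x) - theta)))).
  2:{ intro t; do 2 f_equal; ring. }
  rewrite (period_int_shift (fun s => w s * cos (INR n * s + (- (INR n * x) - theta)))); cont.
  2:{ apply periodic_mult; auto using periodic_cos. }
  rewrite (period_int_lincomb (fun t => w t * cos (INR n * t)) (fun t => w t * sin (INR n * t)) _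
             (cos (INR n * x + theta)) (sin (INR n * x + theta))); cont.
  - unfold fourier_term, fourier_cos, fourier_sin, period_int. field; lra.
  - intro t. replace (- (INR n * x) - theta) with (- (INR n * x + theta)) by ring.
    rewrite cos_plus, cos_neg, sin_neg; ring.
Qed.

Lemma period_int_cos_phase n c : (n <> 0)%nat -> period_int (fun t => cos (INR n * t - c)) = 0.
Proof.
  intros Hn.
  rewrite (period_int_lincomb (fun t => cos (IZR (Z.of_nat n) * t)) (fun t => sin (IZR (Z.of_nat n) * t))
             _ (cos c) (sin c)); cont.
  - rewrite period_int_cos_Z, period_int_sin_Z by lia; ring.
  - intro t; rewrite cos_minus, INR_IZR_INZ; ring.
Qed.

(** Multiplying by [2 * sin (t / 2)] turns the sum into a telescoping one. *)
Lemma dirichlet_closed theta N t :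
  2 * sin (t / 2) * dirichlet theta N t
  = sin (INR (S N) * t + t / 2 - theta) - sin (t / 2 - theta).
Proof.
  assert (E : forall a, 2 * sin (t / 2) * cos a = sin (a + t / 2) - sin (a - t / 2)).
  { intro a; rewrite sin_plus, sin_minus; ring. }
  induction N as [|N IH].
  - unfold dirichlet; rewrite sum_O, E. f_equal; f_equal; simpl INR; field.
  - unfold dirichlet in *; rewrite sum_Sn_R. rewrite Rmult_plus_distr_l, IH, E.
    replace (INR (S (S N)) * t - theta - t / 2) with (INR (S N) * t + t / 2 - theta)
      by (rewrite (S_INR (S N)); field).
    replace (INR (S (S N)) * t - theta + t / 2) with (INR (S (S N)) * t + t / 2 - theta) by ring.
    ring.
Qed.

(** [sin s >= s - s ^ 3 / 6], and [s ^ 2 <= 4]. *)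
Lemma sin_lower_linear s : 0 <= s <= 2 -> s / 3 <= sin s.
Proof.
  intros Hs. assert (s <= PI) by (pose proof PI2_3_2; unfold PI2 in *; lra).
  destruct (sin_bound s 0) as [H1 _]; try lra.
  unfold sin_approx, sin_term in H1; simpl in H1. nra.
Qed.

Lemma sin_half_lower t : - PI <= t <= PI -> Rabs t / 6 <= Rabs (sin (t / 2)).
Proof.
  intros Ht. pose proof PI_4.
  assert (K : forall u, 0 <= u <= PI -> u / 6 <= sin (u / 2)).
  { intros u Hu. assert (u / 2 / 3 <= sin (u / 2)) by (apply sin_lower_linear; lra). lra. }
  destruct (Rle_dec 0 t).
  - rewrite Rabs_right by lra. apply Rle_trans with (sin (t / 2)); [apply K; lra|apply Rle_abs].
  - rewrite Rabs_left by lra. rewrite <- Rabs_Ropp, <- sin_neg.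
    replace (- (t / 2)) with (- t / 2) by field.
    apply Rle_trans with (sin (- t / 2)); [apply K; lra|apply Rle_abs].
Qed.

(** The singularity of the kernel is that of [1 / t], whatever [N]. *)
Lemma dirichlet_bound theta N t : - PI <= t <= PI -> Rabs t * Rabs (dirichlet theta N t) <= 6.
Proof.
  intros Ht. assert (H := sin_half_lower t Ht).
  assert (E := f_equal Rabs (dirichlet_closed theta N t)).
  rewrite !Rabs_mult, (Rabs_right 2) in E by lra.
  assert (Rabs (sin (INR (S N) * t + t / 2 - theta) - sin (t / 2 - theta)) <= 2).
  { pose proof (SIN_bound (INR (S N) * t + t / 2 - theta)). pose proof (SIN_bound (t / 2 - theta)).
    apply Rabs_le; lra. }
  pose proof (Rabs_pos (dirichlet theta N t)). nra.
Qed.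

(** * Weakly singular integrals *)

Lemma Rpower_pos a b : 0 < Rpower a b.
Proof. apply exp_pos. Qed.

(** The majorant is unbounded at [0] when [b < 1]: integrate it from a small [h], and
   use the boundedness of [g] on [[0, h]]. *)
Lemma weakly_singular_half g A b : cont g -> 0 < b -> 0 <= A ->
  (forall t, 0 < t <= PI -> Rabs (g t) <= A * Rpower t (b - 1)) ->
  Rabs (RInt g 0 PI) <= A * (Rpower PI b / b).
Proof.
  intros Hg Hb HA H. pose proof PI_RGT_0.
  destruct (cont_bounded_on g 0 PI) as [M [HM HMb]]; [lra|auto|].
  apply le_epsilon; intros e He.
  pose (h := Rmin PI (e / (M + 1))).
  assert (Hq : 0 < e / (M + 1)) by (apply Rdiv_lt_0_compat; lra).
  assert (Hh : 0 < h) by (apply Rmin_glb_lt; lra).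
  assert (Hh1 : h <= PI) by apply Rmin_l.
  assert (Hh2 : h * M <= e).
  { apply Rle_trans with (e / (M + 1) * (M + 1)); [|right; field; lra].
    apply Rmult_le_compat; try lra. apply Rmin_r. }
  rewrite <- (RInt_Chasles g 0 h PI) by now apply cont_ex_RInt.
  unfold plus; simpl.
  eapply Rle_trans; [apply Rabs_triang|].
  assert (B1 : Rabs (RInt g 0 h) <= (h - 0) * M).
  { apply abs_RInt_le_const; [lra|now apply cont_ex_RInt|]. intros; apply HMb; lra. }
  assert (Hder : forall t, 0 < t -> is_derive (fun t => A * (Rpower t b / b)) t (A * Rpower t (b - 1))).
  { intros t Ht.
    replace (A * Rpower t (b - 1)) with (A * (/ b * (b * Rpower t (b - 1)))) by (field; lra).
    apply is_derive_scal. apply is_derive_ext with (fun t => / b * Rpower t b).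
    - intros; unfold Rdiv; apply Rmult_comm.
    - apply is_derive_scal. apply is_derive_Reals, derivable_pt_lim_power; auto. }
  assert (Hi : is_RInt (fun t => A * Rpower t (b - 1)) h PI
                 (A * (Rpower PI b / b) - A * (Rpower h b / b))).
  { apply (is_RInt_derive (fun t => A * (Rpower t b / b))).
    - intros t Ht. rewrite Rmin_left in Ht by lra. apply Hder; lra.
    - intros t Ht. rewrite Rmin_left in Ht by lra.
      apply (continuous_mult (fun _ => A) (fun t => Rpower t (b - 1))); [apply continuous_const|].
      apply (ex_derive_continuous (fun t => Rpower t (b - 1))).
      exists ((b - 1) * Rpower t (b - 1 - 1)).
      apply is_derive_Reals, derivable_pt_lim_power; lra. }
  assert (B2 : Rabs (RInt g h PI) <= A * (Rpower PI b / b) - A * (Rpower h b / b)).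
  { apply (norm_RInt_le g (fun t => A * Rpower t (b - 1)) h PI); auto.
    - intros t Ht; apply H; lra.
    - apply (RInt_correct g); now apply cont_ex_RInt. }
  assert (0 <= A * (Rpower h b / b)).
  { apply Rmult_le_pos; auto. apply Rlt_le, Rdiv_lt_0_compat; auto using Rpower_pos. }
  lra.
Qed.

Lemma RInt_reflect g : cont g -> RInt g (- PI) 0 = RInt (fun t => g (- t)) 0 PI.
Proof.
  intros Hg.
  assert (H := RInt_comp_lin g (-1) 0 0 PI (cont_ex_RInt _ _ _ Hg)).
  replace (-1 * 0 + 0) with 0 in H by ring. replace (-1 * PI + 0) with (- PI) in H by ring.
  rewrite <- (opp_RInt_swap g) by now apply cont_ex_RInt. rewrite <- H.
  rewrite (RInt_scal (fun t => g (-1 * t + 0))).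
  - unfold opp, scal; simpl; unfold mult; simpl.
    rewrite (RInt_ext (fun t => g (-1 * t + 0)) (fun t => g (- t))); [ring|].
    intros; f_equal; ring.
  - apply cont_ex_RInt. apply (cont_comp (fun t => -1 * t + 0) g); cont.
Qed.

Lemma weakly_singular g A b : cont g -> 0 < b -> 0 <= A ->
  (forall t, 0 < Rabs t <= PI -> Rabs (g t) <= A * Rpower (Rabs t) (b - 1)) ->
  Rabs (period_int g) <= 2 * A * (Rpower PI b / b).
Proof.
  intros Hg Hb HA H. unfold period_int.
  rewrite <- (RInt_Chasles g (- PI) 0 PI) by now apply cont_ex_RInt.
  unfold plus; simpl. rewrite RInt_reflect by auto.
  eapply Rle_trans; [apply Rabs_triang|].
  assert (Rabs (RInt (fun t => g (- t)) 0 PI) <= A * (Rpower PI b / b)).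
  { apply weakly_singular_half; auto.
    - apply (cont_comp (fun t => - t) g); cont.
    - intros t Ht.
      replace (Rpower t (b - 1)) with (Rpower (Rabs (- t)) (b - 1))
        by (rewrite Rabs_Ropp, Rabs_right; lra).
      apply H. rewrite Rabs_Ropp, Rabs_right; lra. }
  assert (Rabs (RInt g 0 PI) <= A * (Rpower PI b / b)).
  { apply weakly_singular_half; auto.
    intros t Ht. replace (Rpower t (b - 1)) with (Rpower (Rabs t) (b - 1))
      by (rewrite Rabs_right; lra).
    apply H. rewrite Rabs_right; lra. }
  lra.
Qed.

(** * Uniform convergence for Hölder functions *)

(** At [x = y] the inequality reads [0 <= K], because [Rpower 0 a = 1]. *)
Definition holder_with (a K : R) (f : R -> R) : Prop :=
  0 <= K /\ forall x y, Rabs (f x - f y) <= K * Rpower (Rabs (x - y)) a.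

Lemma Rpower_mono s t a : 0 < a -> 0 < s <= t -> Rpower s a <= Rpower t a.
Proof. intros Ha Hst; apply Rle_Rpower_l; lra. Qed.

Lemma Rpower_div t b : 0 < t -> Rpower t b = t * Rpower t (b - 1).
Proof.
  intros Ht. rewrite <- (Rpower_1 t) at 2 by auto. rewrite <- Rpower_plus. f_equal; ring.
Qed.

(** The kernel has zero mean, so [r (x + t)] may be replaced by [r (x + t) - r x] under
   the integral; this factor is [O (|t| ^ b)], which makes the singularity [1 / t] of
   the kernel integrable, uniformly in [N]. *)
Lemma holder_partial_sums_bounded b : 0 < b -> exists C, 0 < C /\
  forall L r theta N x, periodic2pi r -> cont r -> holder_with b L r ->
    Rabs (sum_n (fun j => fourier_term theta r (S j) x) N) <= C * L.
Proof.
  intros Hb. pose proof PI_RGT_0.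
  exists (12 * (Rpower PI b / b) / PI). split.
  { assert (0 < Rpower PI b / b) by (apply Rdiv_lt_0_compat; auto using Rpower_pos).
    apply Rdiv_lt_0_compat; lra. }
  intros L r theta N x Hp Hr [HL Hh].
  assert (Hd : cont (dirichlet theta N)).
  { apply (cont_sum (fun j t => cos (INR (S j) * t - theta))). intro; cont. }
  assert (E0 : period_int (dirichlet theta N) = 0).
  { unfold dirichlet. rewrite (period_int_sum (fun j t => cos (INR (S j) * t - theta))).
    - rewrite (sum_n_ext _ (fun _ => 0)); [rewrite sum_n_const; ring|].
      intro; apply period_int_cos_phase; lia.
    - intro; cont. }
  assert (E : sum_n (fun j => fourier_term theta r (S j) x) N
              = period_int (fun t => (r (x + t) - r x) * dirichlet theta N t) / PI).
  { rewrite (period_int_lincomb (fun t => r (x + t) * dirichlet theta N t) (dirichlet theta N) _ 1 (- r x));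
      cont; [|intro; ring].
    rewrite E0.
    rewrite (period_int_ext _ (fun t => sum_n (fun j => r (x + t) * cos (INR (S j) * t - theta)) N)).
    2:{ intro t; unfold dirichlet. symmetry; apply (sum_n_mult_l (r (x + t))). }
    rewrite (period_int_sum (fun j t => r (x + t) * cos (INR (S j) * t - theta))) by (intro; cont).
    rewrite (sum_n_ext _ _ _ (fun j => fourier_term_conv theta r (S j) x Hp Hr)).
    unfold Rdiv. rewrite Rmult_0_r, Rplus_0_r, Rmult_1_l.
    apply (sum_n_mult_r (/ PI)). }
  rewrite E, Rabs_div, (Rabs_right PI) by lra.
  replace (12 * (Rpower PI b / b) / PI * L) with (2 * (6 * L) * (Rpower PI b / b) / PI) by (field; lra).
  apply Rmult_le_compat_r; [apply Rlt_le, Rinv_0_lt_compat; lra|].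
  apply weakly_singular; auto; [cont|lra|].
  intros t [Ht1 Ht2].
  rewrite Rabs_mult.
  specialize (Hh (x + t) x). replace (x + t - x) with t in Hh by ring.
  assert (Hd6 : Rabs t * Rabs (dirichlet theta N t) <= 6).
  { apply dirichlet_bound. apply Rabs_le_between; auto. }
  rewrite Rpower_div in Hh by auto.
  pose proof (Rabs_pos (dirichlet theta N t)).
  set (p := Rpower (Rabs t) (b - 1)) in *.
  assert (0 < p) by apply Rpower_pos.
  apply Rle_trans with (L * (Rabs t * p) * Rabs (dirichlet theta N t)).
  - apply Rmult_le_compat_r; auto.
  - replace (L * (Rabs t * p) * Rabs (dirichlet theta N t))
      with (L * p * (Rabs t * Rabs (dirichlet theta N t))) by ring.
    replace (6 * L * p) with (L * p * 6) by ring.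
    apply Rmult_le_compat_l; auto. apply Rmult_le_pos; lra.
Qed.

Definition average (e : R) (f : R -> R) (x : R) : R := RInt f x (x + e) / e.

Lemma average_shift e f x : cont f -> average e f x = RInt (fun t => f (x + t)) 0 e / e.
Proof. intros Hf; unfold average; rewrite RInt_shift by auto; do 2 f_equal; ring. Qed.

Lemma average_derive e f x : cont f -> e <> 0 ->
  is_derive (average e f) x ((f (x + e) - f x) / e).
Proof.
  intros Hf He.
  assert (Hd : forall y, is_derive (RInt f 0) y (f y)).
  { intro y; apply (is_derive_RInt f (RInt f 0) 0); [|apply Hf].
    apply filter_forall; intro; apply (RInt_correct f), cont_ex_RInt; auto. }
  apply is_derive_ext with (fun y => (RInt f 0 (y + e) - RInt f 0 y) / e).
  - intro y; unfold average. f_equal.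
    assert (C := RInt_Chasles f 0 y (y + e) (cont_ex_RInt _ _ _ Hf) (cont_ex_RInt _ _ _ Hf)).
    unfold plus in C; simpl in C. rewrite <- C; apply Rplus_minus_l.
  - set (F := RInt f 0) in *. clearbody F. auto_derive.
    + split; [exists (f (x + e)); apply Hd|split; [exists (f x); apply Hd|auto]].
    + replace (Derive (fun y : R => F y) (x + e)) with (f (x + e))
        by (symmetry; apply is_derive_unique, Hd).
      replace (Derive (fun y : R => F y) x) with (f x)
        by (symmetry; apply is_derive_unique, Hd).
      field; auto.
Qed.

Lemma average_cont e f : cont f -> e <> 0 -> cont (average e f).
Proof. intros Hf He; eapply is_derive_cont; intro; apply average_derive; auto. Qed.

Lemma average_periodic e f : cont f -> periodic2pi f -> periodic2pi (average e f).
Proof.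
  intros Hf Hp x. rewrite !average_shift by auto. f_equal.
  apply RInt_ext; intros t _. rewrite <- (Hp (x + t)). f_equal; ring.
Qed.

Lemma average_holder_with e f a K : 0 < e -> cont f -> holder_with a K f -> holder_with a K (average e f).
Proof.
  intros He Hf [HK H]; split; auto; intros x y.
  rewrite !average_shift by auto. rewrite <- RIneq.Rdiv_minus_distr, Rabs_div, (Rabs_right e) by lra.
  apply Rle_div_l; auto.
  rewrite <- (Rmult_1_l (RInt _ 0 e)).
  replace (1 * RInt (fun t => f (x + t)) 0 e - RInt (fun t => f (y + t)) 0 e)
    with (1 * RInt (fun t => f (x + t)) 0 e + (-1) * RInt (fun t => f (y + t)) 0 e) by ring.
  rewrite <- RInt_lincomb by cont.
  eapply Rle_trans; [apply (abs_RInt_le_const _ 0 e (K * Rpower (Rabs (x - y)) a)); [lra| |]|].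
  - apply cont_ex_RInt; cont.
  - intros t _. replace (1 * f (x + t) + -1 * f (y + t)) with (f (x + t) - f (y + t)) by ring.
    replace (x - y) with (x + t - (y + t)) by ring. apply H.
  - right; ring.
Qed.

Lemma average_close e f a K x : 0 < e -> 0 < a -> cont f -> holder_with a K f ->
  Rabs (average e f x - f x) <= K * Rpower e a.
Proof.
  intros He Ha Hf [HK H]. rewrite average_shift by auto.
  replace (RInt (fun t => f (x + t)) 0 e / e - f x)
    with ((1 * RInt (fun t => f (x + t)) 0 e + -1 * RInt (fun t => f x) 0 e) / e).
  2:{ rewrite (RInt_const 0 e (f x)). unfold scal; simpl; unfold mult; simpl. field; lra. }
  rewrite <- RInt_lincomb by cont. rewrite Rabs_div, (Rabs_right e) by lra.
  apply Rle_div_l; auto.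
  eapply Rle_trans; [apply (abs_RInt_le_const _ 0 e (K * Rpower e a)); [lra| |]|].
  - apply cont_ex_RInt; cont.
  - intros t [Ht1 Ht2]. replace (1 * f (x + t) + -1 * f x) with (f (x + t) - f x) by ring.
    destruct (Req_dec t 0) as [->|Hne].
    + rewrite Rplus_0_r, Rminus_diag, Rabs_R0. apply Rmult_le_pos; auto. apply Rlt_le, Rpower_pos.
    + eapply Rle_trans; [apply H|]. apply Rmult_le_compat_l; auto.
      replace (x + t - x) with t by ring. rewrite Rabs_right by lra. apply Rpower_mono; lra.
  - right; ring.
Qed.

(** Interpolation: increments are bounded by the Hölder estimate when [|x - y| <= e] and
   by the uniform one otherwise. *)
Lemma holder_with_interpolate r a K e : 0 < e -> 0 < a -> holder_with a K r ->
  (forall x y, Rabs (r x - r y) <= K * Rpower e a) -> holder_with (a / 2) (K * Rpower e (a / 2)) r.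
Proof.
  intros He Ha [HK H] Hs. assert (0 < Rpower e (a / 2)) by apply Rpower_pos.
  split; [apply Rmult_le_pos; lra|]. intros x y.
  assert (Hsq : forall t, Rpower t a = Rpower t (a / 2) * Rpower t (a / 2)).
  { intro t; rewrite <- Rpower_plus; f_equal; field. }
  destruct (Req_dec x y) as [->|Hne].
  { rewrite Rminus_diag, Rabs_R0. repeat apply Rmult_le_pos; auto; apply Rlt_le, Rpower_pos. }
  assert (Ht : 0 < Rabs (x - y)) by (apply Rabs_pos_lt; lra).
  set (t := Rabs (x - y)) in *. assert (0 < Rpower t (a / 2)) by apply Rpower_pos.
  rewrite Rmult_assoc.
  destruct (Rle_dec t e) as [Hle|Hgt].
  - eapply Rle_trans; [apply H|]. apply Rmult_le_compat_l; auto. fold t. rewrite Hsq.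
    apply Rmult_le_compat_r; [lra|]. apply Rpower_mono; lra.
  - eapply Rle_trans; [apply Hs|]. apply Rmult_le_compat_l; auto. rewrite Hsq.
    apply Rmult_le_compat_l; [lra|]. apply Rpower_mono; lra.
Qed.

Lemma fourier_cos_period_int w n : fourier_cos w n = period_int (fun x => w x * cos (INR n * x)) / PI.
Proof. reflexivity. Qed.

Lemma fourier_sin_period_int w n : fourier_sin w n = period_int (fun x => w x * sin (INR n * x)) / PI.
Proof. reflexivity. Qed.

Lemma fourier_cos_lincomb f g c d n : cont f -> cont g ->
  fourier_cos (fun x => c * f x + d * g x) n = c * fourier_cos f n + d * fourier_cos g n.
Proof.
  intros Hf Hg. pose proof PI_RGT_0. rewrite !fourier_cos_period_int.
  rewrite (period_int_lincomb (fun x => f x * cos (INR n * x)) (fun x => g x * cos (INR n * x)) _ c d); cont.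
  - field; lra.
  - intro; ring.
Qed.

Lemma fourier_sin_lincomb f g c d n : cont f -> cont g ->
  fourier_sin (fun x => c * f x + d * g x) n = c * fourier_sin f n + d * fourier_sin g n.
Proof.
  intros Hf Hg. pose proof PI_RGT_0. rewrite !fourier_sin_period_int.
  rewrite (period_int_lincomb (fun x => f x * sin (INR n * x)) (fun x => g x * sin (INR n * x)) _ c d); cont.
  - field; lra.
  - intro; ring.
Qed.

Lemma fourier_cos_ext f g n : (forall x, f x = g x) -> fourier_cos f n = fourier_cos g n.
Proof. intros E; unfold fourier_cos; f_equal; apply RInt_ext; intros; now rewrite E. Qed.

Lemma fourier_sin_ext f g n : (forall x, f x = g x) -> fourier_sin f n = fourier_sin g n.
Proof. intros E; unfold fourier_sin; f_equal; apply RInt_ext; intros; now rewrite E. Qed.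

Lemma fourier_term_bound theta w n x M :
  Rabs (fourier_cos w n) <= M -> Rabs (fourier_sin w n) <= M ->
  Rabs (fourier_term theta w n x) <= 2 * M.
Proof.
  intros H1 H2. unfold fourier_term. eapply Rle_trans; [apply Rabs_triang|].
  rewrite !Rabs_mult.
  assert (Rabs (cos (INR n * x + theta)) <= 1) by apply Rabs_le, COS_bound.
  assert (Rabs (sin (INR n * x + theta)) <= 1) by apply Rabs_le, SIN_bound.
  pose proof (Rabs_pos (fourier_cos w n)). pose proof (Rabs_pos (fourier_sin w n)). nra.
Qed.

(** Two integrations by parts make the coefficients [O (1 / n ^ 2)]. *)
Lemma C2_fourier_unif_cauchy theta (f g h : R -> R) : periodic2pi f -> periodic2pi g -> periodic2pi h ->
  (forall x, is_derive f x (g x)) -> (forall x, is_derive g x (h x)) -> cont h ->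
  unif_cauchy (fun N x => sum_n (fun j => fourier_term theta f (S j) x) N).
Proof.
  intros Pf Pg Ph Dfg Dgh Hh. assert (Hg := is_derive_cont g h Dgh).
  destruct (periodic_bounded h Ph Hh) as [M [HM HMb]].
  apply unif_cauchy_dominated with (fun j => 4 * M * / INR (S j) ^ 2).
  - intros j x. assert (Hn : 0 < INR (S j)) by (apply lt_0_INR; lia).
    set (n := S j) in *. assert (Hi : 0 < / INR n ^ 2) by (apply Rinv_0_lt_compat; nra).
    replace (4 * M * / INR n ^ 2) with (2 * (2 * M * / INR n ^ 2)) by ring.
    assert (Ec : fourier_cos f n = - fourier_cos h n * / INR n ^ 2).
    { rewrite (fourier_cos_derive g h), (fourier_sin_derive f g) by auto. field; lra. }
    assert (Es : fourier_sin f n = - fourier_sin h n * / INR n ^ 2).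
    { rewrite (fourier_sin_derive g h), (fourier_cos_derive f g) by auto. field; lra. }
    apply fourier_term_bound.
    + rewrite Ec, Rabs_mult, Rabs_Ropp, (Rabs_right (/ _)) by lra.
      apply Rmult_le_compat_r; [lra|]. now apply fourier_cos_bound.
    + rewrite Es, Rabs_mult, Rabs_Ropp, (Rabs_right (/ _)) by lra.
      apply Rmult_le_compat_r; [lra|]. now apply fourier_sin_bound.
  - apply (ex_series_scal_l (4 * M) (fun j => / INR (S j) ^ 2)), ex_series_inv_sq.
Qed.

(** Averaging [w] twice over intervals of length [s] gives a function of class C^2,
   whose series converges absolutely.  The remainder has a small Hölder constant
   when [s] is small, so that its partial sums are uniformly small. *)
Lemma holder_fourier_unif_cauchy theta w a K : periodic2pi w -> cont w -> 0 < a -> holder_with a K w ->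
  unif_cauchy (fun N x => sum_n (fun j => fourier_term theta w (S j) x) N).
Proof.
  intros Hp Hw Ha HK e He. pose proof (proj1 HK) as HK0.
  destruct (holder_partial_sums_bounded (a / 2)) as [C [HC Hbd]]; [lra|].
  assert (Hpos : 0 < 8 * C * (2 * K + 1)) by (repeat apply Rmult_lt_0_compat; lra).
  pose (delta := e / (8 * C * (2 * K + 1))).
  assert (Hdelta : 0 < delta) by (now apply Rdiv_lt_0_compat).
  (* [delta] makes the partial sums of the remainder at most [e / 4]; [s] has [s ^ (a / 2) = delta] *)
  pose (s := Rpower delta (/ (a / 2))).
  assert (Hs : 0 < s) by apply Rpower_pos.
  assert (Es : Rpower s (a / 2) = delta).
  { unfold s. rewrite Rpower_mult, Rinv_l, Rpower_1; lra. }
  clearbody s.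
  pose (w1 := average s w). pose (w2 := average s w1).
  assert (C1 : cont w1) by (apply average_cont; auto; lra).
  assert (C2 : cont w2) by (apply average_cont; auto; lra).
  assert (P1 : periodic2pi w1) by (now apply average_periodic).
  assert (P2 : periodic2pi w2) by (now apply average_periodic).
  assert (H1 : holder_with a K w1) by (now apply average_holder_with).
  assert (H2 : holder_with a K w2) by (now apply average_holder_with).
  assert (Hsmall : unif_cauchy (fun N x => sum_n (fun j => fourier_term theta w2 (S j) x) N)).
  { pose (g := fun x => (w1 (x + s) - w1 x) / s).
    pose (h := fun x => ((w (x + s + s) - w (x + s)) / s - (w (x + s) - w x) / s) / s).
    assert (Hsh : forall f, periodic2pi f -> forall x, f (x + 2 * PI + s) = f (x + s)).
    { intros f Hf x; rewrite <- (Hf (x + s)); f_equal; ring. }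
    apply (C2_fourier_unif_cauchy theta w2 g h); auto.
    - intros x; unfold g; now rewrite Hsh, P1.
    - intros x; unfold h. rewrite (Hsh w Hp x), Hp.
      replace (w (x + 2 * PI + s + s)) with (w (x + s + s)); auto.
      rewrite <- Hp; f_equal; ring.
    - intros x; apply average_derive; auto; lra.
    - intros x; unfold g, h. auto_derive.
      + split; [|split; auto]; eexists; apply average_derive; auto; lra.
      + replace (Derive (fun y : R => w1 y) (x + s)) with ((w (x + s + s) - w (x + s)) / s)
          by (symmetry; apply is_derive_unique, average_derive; auto; lra).
        replace (Derive (fun y : R => w1 y) x) with ((w (x + s) - w x) / s)
          by (symmetry; apply is_derive_unique, average_derive; auto; lra).
        field; lra.
    - unfold h; cont. }
  pose (r := fun x => 1 * w x + (-1) * w2 x).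
  assert (Cr : cont r) by (unfold r; cont).
  assert (Pr : periodic2pi r) by (intro x; unfold r; now rewrite Hp, P2).
  assert (Hr : holder_with (a / 2) (4 * K * Rpower s (a / 2)) r).
  { apply holder_with_interpolate; auto.
    - split; [lra|]. intros x y. unfold r.
      replace (1 * w x + -1 * w2 x - (1 * w y + -1 * w2 y)) with ((w x - w y) - (w2 x - w2 y)) by ring.
      eapply Rle_trans; [apply Rabs_triang|]. rewrite Rabs_Ropp.
      destruct HK as [_ HK]. destruct H2 as [_ H2]. specialize (HK x y). specialize (H2 x y).
      pose proof (Rpower_pos (Rabs (x - y)) a). nra.
    - assert (Q : forall x, Rabs (r x) <= 2 * K * Rpower s a).
      { intro x. unfold r.
        replace (1 * w x + -1 * w2 x) with (- ((w2 x - w1 x) + (w1 x - w x))) by ring.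
        rewrite Rabs_Ropp. eapply Rle_trans; [apply Rabs_triang|].
        assert (Rabs (w2 x - w1 x) <= K * Rpower s a) by (apply average_close; auto).
        assert (Rabs (w1 x - w x) <= K * Rpower s a) by (apply average_close; auto). lra. }
      intros x y. eapply Rle_trans; [apply Rabs_triang|]. rewrite Rabs_Ropp.
      specialize (Q x) as Qx. specialize (Q y). lra. }
  rewrite Es in Hr.
  destruct (Hsmall (e / 2)) as [N0 HN0]; [lra|].
  assert (Esum : forall N x, sum_n (fun j => fourier_term theta w (S j) x) N
      = sum_n (fun j => fourier_term theta w2 (S j) x) N + sum_n (fun j => fourier_term theta r (S j) x) N).
  { intros N x. rewrite <- (sum_n_plus (G := R_AbelianMonoid)). apply sum_n_ext; intro j.
    unfold fourier_term, r. rewrite fourier_cos_lincomb, fourier_sin_lincomb by auto.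
    unfold plus; simpl. ring. }
  exists N0; intros m n Hm Hn x. rewrite !Esum.
  specialize (HN0 m n Hm Hn x).
  assert (B1 := Hbd _ r theta m x Pr Cr Hr). assert (B2 := Hbd _ r theta n x Pr Cr Hr).
  assert (HCd : C * (4 * K * delta) <= e / 4).
  { apply Rle_trans with (C * (2 * (2 * K + 1) * delta)).
    - apply Rmult_le_compat_l; nra.
    - unfold delta. right; field; lra. }
  apply Rabs_le_between in HN0, B1, B2. apply Rabs_le. lra.
Qed.

(** * The Fourier series of a Hölder function *)

Definition holder_fun (w : R -> R) : Prop :=
  periodic2pi w /\ cont w /\ exists a K, 0 < a /\ holder_with a K w.

Lemma period_int_cos_cos i j : period_int (fun x => cos (INR (S i) * x) * cos (INR j * x))
  = if Nat.eqb (S i) j then PI else 0.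
Proof.
  rewrite (period_int_lincomb (fun x => cos (IZR (Z.of_nat (S i) + Z.of_nat j) * x))
    (fun x => cos (IZR (Z.of_nat (S i) - Z.of_nat j) * x)) _ (1/2) (1/2)); cont.
  - rewrite (period_int_cos_Z (Z.of_nat (S i) + Z.of_nat j)) by lia.
    destruct (Nat.eqb_spec (S i) j) as [<-|Hne].
    + rewrite Z.sub_diag, (period_int_ext _ (fun _ => 1)), period_int_const; [field|].
      intro; rewrite Rmult_0_l; apply cos_0.
    + rewrite period_int_cos_Z by lia; ring.
  - intro x. rewrite plus_IZR, minus_IZR, <- !INR_IZR_INZ, Rmult_plus_distr_r, Rmult_minus_distr_r.
    rewrite cos_plus, cos_minus; field.
Qed.

Lemma period_int_sin_sin i j : period_int (fun x => sin (INR (S i) * x) * sin (INR j * x))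
  = if Nat.eqb (S i) j then PI else 0.
Proof.
  rewrite (period_int_lincomb (fun x => cos (IZR (Z.of_nat (S i) - Z.of_nat j) * x))
    (fun x => cos (IZR (Z.of_nat (S i) + Z.of_nat j) * x)) _ (1/2) (-1/2)); cont.
  - rewrite (period_int_cos_Z (Z.of_nat (S i) + Z.of_nat j)) by lia.
    destruct (Nat.eqb_spec (S i) j) as [<-|Hne].
    + rewrite Z.sub_diag, (period_int_ext _ (fun _ => 1)), period_int_const; [field|].
      intro; rewrite Rmult_0_l; apply cos_0.
    + rewrite period_int_cos_Z by lia; ring.
  - intro x. rewrite plus_IZR, minus_IZR, <- !INR_IZR_INZ, Rmult_plus_distr_r, Rmult_minus_distr_r.
    rewrite cos_plus, cos_minus; field.
Qed.

Lemma period_int_sin_cos i j : period_int (fun x => sin (INR i * x) * cos (INR j * x)) = 0.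
Proof.
  rewrite (period_int_lincomb (fun x => sin (IZR (Z.of_nat i + Z.of_nat j) * x))
    (fun x => sin (IZR (Z.of_nat i - Z.of_nat j) * x)) _ (1/2) (1/2)); cont.
  - rewrite !period_int_sin_Z; ring.
  - intro x. rewrite plus_IZR, minus_IZR, <- !INR_IZR_INZ, Rmult_plus_distr_r, Rmult_minus_distr_r.
    rewrite sin_plus, sin_minus; field.
Qed.

(** The sums run over the frequencies [S j], hence the exclusion of [m = 0]. *)
Lemma sum_n_delta (a : nat -> R) m N :
  sum_n (fun j => if Nat.eqb (S j) m then a (S j) else 0) N
  = if andb (Nat.leb 1 m) (Nat.leb m (S N)) then a m else 0.
Proof.
  induction N as [|N IH].
  - rewrite sum_O. destruct m as [|[|m]]; reflexivity.
  - rewrite sum_Sn_R, IH. destruct m as [|m]; [simpl; ring|].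
    destruct (Nat.eqb_spec (S (S N)) (S m)) as [E|E].
    + injection E as <-. replace (Nat.leb (S (S N)) (S N)) with false by (symmetry; apply Nat.leb_gt; lia).
      replace (Nat.leb (S (S N)) (S (S N))) with true by (symmetry; apply Nat.leb_le; lia). simpl; ring.
    + destruct (Nat.leb_spec (S m) (S N)); destruct (Nat.leb_spec (S m) (S (S N))); simpl; try lia; ring.
Qed.

Definition fourier_sum (w : R -> R) (N : nat) (x : R) : R :=
  sum_n (fun j => fourier_term 0 w (S j) x) N.

Lemma fourier_term_0 w n x :
  fourier_term 0 w n x = fourier_cos w n * cos (INR n * x) + fourier_sin w n * sin (INR n * x).
Proof. unfold fourier_term; now rewrite Rplus_0_r. Qed.

Lemma fourier_term_cont theta w n : cont (fourier_term theta w n).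
Proof. unfold fourier_term; cont. Qed.

Lemma fourier_sum_cont w N : cont (fourier_sum w N).
Proof. apply (cont_sum (fun j => fourier_term 0 w (S j))); intro; apply fourier_term_cont. Qed.

Lemma fourier_sum_cos w N n : (n <= N)%nat ->
  period_int (fun x => fourier_sum w N x * cos (INR n * x)) = if Nat.eqb n 0 then 0 else PI * fourier_cos w n.
Proof.
  intros Hn. pose proof (fourier_term_cont 0 w) as Hc.
  rewrite (period_int_ext _ (fun x => sum_n (fun j => fourier_term 0 w (S j) x * cos (INR n * x)) N)).
  2:{ intro x; symmetry; apply (sum_n_mult_r (cos (INR n * x))). }
  rewrite (period_int_sum (fun j x => fourier_term 0 w (S j) x * cos (INR n * x))).
  2:{ intro j; specialize (Hc (S j)); cont. }
  rewrite (sum_n_ext _ (fun j => if Nat.eqb (S j) n then PI * fourier_cos w (S j) else 0)).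
  - rewrite (sum_n_delta (fun m => PI * fourier_cos w m)).
    replace (Nat.leb n (S N)) with true by (symmetry; apply Nat.leb_le; lia).
    destruct n; reflexivity.
  - intro j. rewrite (period_int_lincomb (fun x => cos (INR (S j) * x) * cos (INR n * x))
      (fun x => sin (INR (S j) * x) * cos (INR n * x)) _ (fourier_cos w (S j)) (fourier_sin w (S j)));
      cont.
    + rewrite period_int_cos_cos, period_int_sin_cos. destruct (Nat.eqb (S j) n); eq_in_R; ring.
    + intro x; rewrite fourier_term_0; ring.
Qed.

Lemma fourier_sum_sin w N n : (n <= N)%nat ->
  period_int (fun x => fourier_sum w N x * sin (INR n * x)) = if Nat.eqb n 0 then 0 else PI * fourier_sin w n.
Proof.
  intros Hn. pose proof (fourier_term_cont 0 w) as Hc.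
  rewrite (period_int_ext _ (fun x => sum_n (fun j => fourier_term 0 w (S j) x * sin (INR n * x)) N)).
  2:{ intro x; symmetry; apply (sum_n_mult_r (sin (INR n * x))). }
  rewrite (period_int_sum (fun j x => fourier_term 0 w (S j) x * sin (INR n * x))).
  2:{ intro j; specialize (Hc (S j)); cont. }
  rewrite (sum_n_ext _ (fun j => if Nat.eqb (S j) n then PI * fourier_sin w (S j) else 0)).
  - rewrite (sum_n_delta (fun m => PI * fourier_sin w m)).
    replace (Nat.leb n (S N)) with true by (symmetry; apply Nat.leb_le; lia).
    destruct n; reflexivity.
  - intro j. rewrite (period_int_lincomb (fun x => sin (INR n * x) * cos (INR (S j) * x))
      (fun x => sin (INR (S j) * x) * sin (INR n * x)) _ (fourier_cos w (S j)) (fourier_sin w (S j)));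
      cont.
    + rewrite period_int_sin_sin, period_int_sin_cos. destruct (Nat.eqb (S j) n); eq_in_R; ring.
    + intro x; rewrite fourier_term_0; ring.
Qed.

Lemma unif_lim_periodic fn f : (forall n, periodic2pi (fn n)) -> unif_lim fn f -> periodic2pi f.
Proof.
  intros Hp Hl x. apply cond_eq. intros e He.
  destruct (Hl (e / 4)) as [N HN]; [lra|].
  specialize (HN N (le_n _)) as H1. specialize (H1 x) as H2. specialize (H1 (x + 2 * PI)).
  rewrite Hp in H1. apply Rabs_le_between in H1, H2. apply Rabs_def1; lra.
Qed.

Lemma fourier_term_periodic theta w n : periodic2pi (fourier_term theta w n).
Proof.
  intro x; unfold fourier_term.
  replace (INR n * (x + 2 * PI) + theta) with (INR n * x + theta + 2 * INR n * PI) by ring.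
  now rewrite cos_period, sin_period.
Qed.

Lemma mean_period_int f : mean f = period_int f / (2 * PI).
Proof. reflexivity. Qed.

(** The series converges uniformly to a function which has the same Fourier
   coefficients as [w], hence is [w]. *)
Lemma fourier_sum_lim w : holder_fun w -> mean w = 0 -> unif_lim (fourier_sum w) w.
Proof.
  intros [Hp [Hw [a [K [Ha HK]]]]] Hm. pose proof PI_RGT_0.
  assert (H0 : period_int w = 0).
  { rewrite mean_period_int in Hm. apply (Rmult_eq_reg_r (/ (2 * PI))); [unfold Rdiv in Hm; lra|].
    apply Rinv_neq_0_compat; lra. }
  assert (HL := unif_cauchy_lim _ (holder_fourier_unif_cauchy 0 w a K Hp Hw Ha HK)).
  fold (fourier_sum w) in HL.
  change (fun n x => sum_n (fun j => fourier_term 0 w (S j) x) n) with (fourier_sum w) in HL.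
  set (g := fun x => real (Lim_seq (fun n => sum_n (fun j => fourier_term 0 w (S j) x) n))) in HL.
  assert (Hg : cont g) by (apply (unif_lim_cont (fourier_sum w)); auto using fourier_sum_cont).
  assert (Pg : periodic2pi g).
  { apply (unif_lim_periodic (fourier_sum w)); auto. intros n x. unfold fourier_sum.
    apply sum_n_ext; intro; apply fourier_term_periodic. }
  assert (Heq : forall x, 1 * w x + -1 * g x = 0).
  { apply fourier_unique; [intro x; now rewrite Hp, Pg|cont| |]; intro n.
    - assert (L := unif_lim_period_int _ g (fun x => cos (INR n * x)) (fourier_sum_cont w) Hg
                     ltac:(cont) HL).
      rewrite (period_int_lincomb (fun t => w t * cos (INR n * t)) (fun t => g t * cos (INR n * t)) _ 1 (-1));
        cont; [|intro; ring].
      assert (L2 : is_lim_seq (fun N => period_int (fun x => fourier_sum w N x * cos (INR n * x)))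
                     (period_int (fun t => w t * cos (INR n * t)))).
      { apply (is_lim_seq_ext_loc (fun _ => period_int (fun t => w t * cos (INR n * t))));
          [|apply is_lim_seq_const].
        exists n; intros N HN. rewrite fourier_sum_cos by auto. destruct n as [|n]; simpl Nat.eqb.
        - rewrite <- H0. apply period_int_ext; intro; simpl; rewrite Rmult_0_l, cos_0; ring.
        - cbv iota. rewrite fourier_cos_period_int. field; lra. }
      apply is_lim_seq_unique in L, L2. rewrite L in L2. injection L2 as L2. rewrite L2; ring.
    - assert (L := unif_lim_period_int _ g (fun x => sin (INR n * x)) (fourier_sum_cont w) Hg
                     ltac:(cont) HL).
      rewrite (period_int_lincomb (fun t => w t * sin (INR n * t)) (fun t => g t * sin (INR n * t)) _ 1 (-1));
        cont; [|intro; ring].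
      assert (L2 : is_lim_seq (fun N => period_int (fun x => fourier_sum w N x * sin (INR n * x)))
                     (period_int (fun t => w t * sin (INR n * t)))).
      { apply (is_lim_seq_ext_loc (fun _ => period_int (fun t => w t * sin (INR n * t))));
          [|apply is_lim_seq_const].
        exists n; intros N HN. rewrite fourier_sum_sin by auto. destruct n as [|n]; simpl Nat.eqb.
        - cbv iota. rewrite (period_int_ext _ (fun _ => 0)); [rewrite period_int_const; ring|].
          intro; simpl; rewrite Rmult_0_l, sin_0; ring.
        - cbv iota. rewrite fourier_sin_period_int. field; lra. }
      apply is_lim_seq_unique in L, L2. rewrite L in L2. injection L2 as L2. rewrite L2; ring. }
  intros e He. destruct (HL e He) as [N HN]; exists N; intros n Hn x.
  replace (w x) with (g x) by (specialize (Heq x); lra). auto.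
Qed.

(** * The Hilbert transform of the strip *)

Definition hilbert_sum (d : R) (w : R -> R) (N : nat) (x : R) : R :=
  sum_n (fun j => coth (INR (S j) * d) *
      (fourier_cos w (S j) * sin (INR (S j) * x) - fourier_sin w (S j) * cos (INR (S j) * x))) N.

Lemma hilbert_sum_cont d w N : cont (hilbert_sum d w N).
Proof.
  apply (cont_sum (fun j x => coth (INR (S j) * d) *
      (fourier_cos w (S j) * sin (INR (S j) * x) - fourier_sin w (S j) * cos (INR (S j) * x)))).
  intro; cont.
Qed.

Lemma sinh_pos x : 0 < x -> 0 < sinh x.
Proof. intro H; rewrite <- sinh_0; now apply sinh_lt. Qed.

Lemma coth_minus_1_bound d j : 0 < d ->
  Rabs (coth (INR (S j) * d) - 1) <= / sinh d * exp (- d) ^ j.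
Proof.
  intros Hd. pose proof (pos_INR j).
  assert (Hle : d <= INR (S j) * d) by (rewrite S_INR; nra).
  assert (Hs : 0 < sinh d) by (now apply sinh_pos).
  assert (Hs2 : sinh d <= sinh (INR (S j) * d)).
  { destruct Hle as [Hlt|Heq]; [left; now apply sinh_lt|right; now rewrite Heq at 1]. }
  assert (E : coth (INR (S j) * d) - 1 = exp (- (INR (S j) * d)) * / sinh (INR (S j) * d)).
  { unfold coth. apply (Rmult_eq_reg_r (sinh (INR (S j) * d))); [|lra].
    replace ((cosh (INR (S j) * d) / sinh (INR (S j) * d) - 1) * sinh (INR (S j) * d))
      with (cosh (INR (S j) * d) - sinh (INR (S j) * d)) by (field; lra).
    rewrite Rmult_assoc, Rinv_l by lra. unfold cosh, sinh; field. }
  assert (Hexp : exp (- (INR (S j) * d)) <= exp (- d) ^ j).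
  { rewrite <- Rpower_pow by apply exp_pos. unfold Rpower. rewrite ln_exp.
    destruct (Req_dec (- (INR (S j) * d)) (INR j * - d)) as [->|Hne]; [lra|].
    left; apply exp_increasing. rewrite S_INR in *; nra. }
  pose proof (exp_pos (- (INR (S j) * d))).
  assert (0 < / sinh (INR (S j) * d)) by (apply Rinv_0_lt_compat; lra).
  rewrite E, Rabs_right by (apply Rle_ge, Rlt_le, Rmult_lt_0_compat; auto).
  rewrite Rmult_comm. apply Rmult_le_compat; try lra.
  apply Rinv_le_contravar; lra.
Qed.

(** [coth (n d) = 1 + O (exp (- n d))]: the transform of the strip is the
   conjugate series plus a series dominated by a geometric one. *)
Lemma hilbert_sum_lim d w : 0 < d -> holder_fun w -> unif_lim (hilbert_sum d w) (strip_hilbert d w).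
Proof.
  intros Hd [Hp [Hw [a [K [Ha HK]]]]].
  apply (unif_cauchy_lim (hilbert_sum d w)).
  assert (Eterm : forall n x, fourier_cos w n * sin (INR n * x) - fourier_sin w n * cos (INR n * x)
                    = fourier_term (- (PI / 2)) w n x).
  { intros n x; unfold fourier_term.
    rewrite cos_plus, sin_plus, cos_neg, sin_neg, cos_PI2, sin_PI2; ring. }
  apply unif_cauchy_ext with (fun N x => sum_n (fun j => fourier_term (- (PI / 2)) w (S j) x) N
     + sum_n (fun j => (coth (INR (S j) * d) - 1) * fourier_term (- (PI / 2)) w (S j) x) N).
  { intros N x. rewrite <- (sum_n_plus (G := R_AbelianMonoid)). apply sum_n_ext; intro j.
    rewrite Eterm. unfold plus; simpl. ring. }
  apply unif_cauchy_plus; [now apply (holder_fourier_unif_cauchy _ w a K)|].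
  destruct (periodic_bounded w Hp Hw) as [M [HM HMb]].
  apply unif_cauchy_dominated with (fun j => (/ sinh d * (2 * (2 * M))) * exp (- d) ^ j).
  - intros j x. rewrite Rabs_mult.
    replace (/ sinh d * (2 * (2 * M)) * exp (- d) ^ j) with (/ sinh d * exp (- d) ^ j * (2 * (2 * M)))
      by ring.
    apply Rmult_le_compat; auto using Rabs_pos, coth_minus_1_bound.
    apply fourier_term_bound; [now apply fourier_cos_bound|now apply fourier_sin_bound].
  - apply (ex_series_scal_l (/ sinh d * (2 * (2 * M))) (fun j => exp (- d) ^ j)).
    apply ex_series_geom. rewrite Rabs_right by (apply Rle_ge, Rlt_le, exp_pos).
    rewrite <- exp_0; apply exp_increasing; lra.
Qed.

Lemma strip_hilbert_cont d w : 0 < d -> holder_fun w -> cont (strip_hilbert d w).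
Proof.
  intros Hd Hw; apply (unif_lim_cont (hilbert_sum d w));
    auto using hilbert_sum_cont, hilbert_sum_lim.
Qed.

Lemma strip_hilbert_periodic d w : periodic2pi (strip_hilbert d w).
Proof.
  intro x; unfold strip_hilbert; apply Series_ext; intro j.
  replace (INR (S j) * (x + 2 * PI)) with (INR (S j) * x + 2 * INR (S j) * PI) by ring.
  now rewrite cos_period, sin_period.
Qed.

(** The Dirichlet-to-Neumann operator [u |-> C_d u'] multiplies the coefficients of
   frequency [n] by [n coth (n d)], so it is symmetric. *)
Lemma hilbert_derive_symmetric d u u' v v' : 0 < d ->
  periodic2pi u -> periodic2pi v ->
  (forall x, is_derive u x (u' x)) -> (forall x, is_derive v x (v' x)) ->
  holder_fun u' -> holder_fun v' ->
  period_int (fun x => strip_hilbert d u' x * v x) = period_int (fun x => strip_hilbert d v' x * u x).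
Proof.
  intros Hd Pu Pv Du Dv Hu' Hv'. pose proof PI_RGT_0.
  assert (Cu' : cont u') by apply Hu'. assert (Cv' : cont v') by apply Hv'.
  assert (Cu := is_derive_cont u u' Du). assert (Cv := is_derive_cont v v' Dv).
  assert (L1 := unif_lim_period_int _ _ v (hilbert_sum_cont d u') (strip_hilbert_cont d u' Hd Hu') Cv
                  (hilbert_sum_lim d u' Hd Hu')).
  assert (L2 := unif_lim_period_int _ _ u (hilbert_sum_cont d v') (strip_hilbert_cont d v' Hd Hv') Cu
                  (hilbert_sum_lim d v' Hd Hv')).
  assert (K : forall f g f', periodic2pi f -> (forall x, is_derive f x (f' x)) -> cont f' -> cont g ->
     forall N, period_int (fun x => hilbert_sum d f' N x * g x) = sum_n (fun j => PI * coth (INR (S j) * d) * INR (S j) *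
        (fourier_sin f (S j) * fourier_sin g (S j) + fourier_cos f (S j) * fourier_cos g (S j))) N).
  { intros f g f' Pf Df Cf' Cg N. unfold hilbert_sum.
    rewrite (period_int_ext _ (fun x => sum_n (fun j => (coth (INR (S j) * d) *
      (fourier_cos f' (S j) * sin (INR (S j) * x) - fourier_sin f' (S j) * cos (INR (S j) * x))) * g x) N)).
    2:{ intro x; symmetry; apply (sum_n_mult_r (g x)). }
    rewrite (period_int_sum (fun j x => (coth (INR (S j) * d) *
      (fourier_cos f' (S j) * sin (INR (S j) * x) - fourier_sin f' (S j) * cos (INR (S j) * x))) * g x))
      by (intro; cont).
    apply sum_n_ext; intro j.
    rewrite (fourier_cos_derive f f'), (fourier_sin_derive f f') by auto.
    rewrite (period_int_lincomb (fun x => g x * sin (INR (S j) * x)) (fun x => g x * cos (INR (S j) * x)) _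
      (coth (INR (S j) * d) * (INR (S j) * fourier_sin f (S j)))
      (coth (INR (S j) * d) * (INR (S j) * fourier_cos f (S j)))); cont.
    - rewrite (fourier_sin_period_int g), (fourier_cos_period_int g). eq_in_R; field; lra.
    - intro; ring. }
  apply (is_lim_seq_ext _ (fun N => period_int (fun x => hilbert_sum d v' N x * u x))) in L1.
  - apply is_lim_seq_unique in L1, L2. rewrite L1 in L2. injection L2; auto.
  - intro N. rewrite (K u v u'), (K v u v') by auto. apply sum_n_ext; intro; eq_in_R; ring.
Qed.

(** * Boundary values of holomorphic functions in the strip *)

(** With [h = A + i B] on the top line, the integrals are the imaginary parts of those of
   [h cos (n (x + i d))] and [h sin (n (x + i d))].  If [h] extends to a periodic
   holomorphic function of [x + i y] which is real on the line [y = - d], Cauchy's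
   theorem moves the integrals to that line, where the integrands are real.  The
   relations say that the coefficients of [A] are those of [C_d B], except for the
   mean, and that [B] has mean zero. *)
Definition strip_boundary (d : R) (A B : R -> R) : Prop :=
  cont A /\ cont B /\
  (forall n, period_int (fun x => B x * (cos (IZR n * x) * cosh (IZR n * d))
                          - A x * (sin (IZR n * x) * sinh (IZR n * d))) = 0) /\
  (forall n, period_int (fun x => B x * (sin (IZR n * x) * cosh (IZR n * d))
                          + A x * (cos (IZR n * x) * sinh (IZR n * d))) = 0).

Lemma strip_boundary_ext d A B A' B' : (forall x, A x = A' x) -> (forall x, B x = B' x) ->
  strip_boundary d A B -> strip_boundary d A' B'.
Proof.
  intros EA EB [HA [HB [Hc Hs]]].
  split; [now apply (cont_ext A)|]. split; [now apply (cont_ext B)|].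
  split; intro n.
  - rewrite <- (Hc n). apply period_int_ext; intro; now rewrite EA, EB.
  - rewrite <- (Hs n). apply period_int_ext; intro; now rewrite EA, EB.
Qed.

Lemma strip_boundary_lincomb d a A1 B1 b A2 B2 :
  strip_boundary d A1 B1 -> strip_boundary d A2 B2 ->
  strip_boundary d (fun x => a * A1 x + b * A2 x) (fun x => a * B1 x + b * B2 x).
Proof.
  intros [HA1 [HB1 [Hc1 Hs1]]] [HA2 [HB2 [Hc2 Hs2]]].
  split; [cont|]. split; [cont|]. split; intro n.
  - rewrite (period_int_lincomb (fun x => B1 x * (cos (IZR n * x) * cosh (IZR n * d))
                          - A1 x * (sin (IZR n * x) * sinh (IZR n * d)))
               (fun x => B2 x * (cos (IZR n * x) * cosh (IZR n * d))
                          - A2 x * (sin (IZR n * x) * sinh (IZR n * d))) _ a b); cont; [|intro; ring].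
    rewrite Hc1, Hc2; ring.
  - rewrite (period_int_lincomb (fun x => B1 x * (sin (IZR n * x) * cosh (IZR n * d))
                          + A1 x * (cos (IZR n * x) * sinh (IZR n * d)))
               (fun x => B2 x * (sin (IZR n * x) * cosh (IZR n * d))
                          + A2 x * (cos (IZR n * x) * sinh (IZR n * d))) _ a b); cont; [|intro; ring].
    rewrite Hs1, Hs2; ring.
Qed.

Lemma strip_boundary_one d : strip_boundary d (fun _ => 1) (fun _ => 0).
Proof.
  split; [cont|]. split; [cont|]. split; intro n.
  - rewrite (period_int_scal (fun x => sin (IZR n * x)) _ (- sinh (IZR n * d))); cont; [|intro; ring].
    rewrite period_int_sin_Z; ring.
  - rewrite (period_int_scal (fun x => cos (IZR n * x)) _ (sinh (IZR n * d))); cont; [|intro; ring].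
    destruct (Z.eq_dec n 0) as [->|Hn].
    + rewrite Rmult_0_l, sinh_0; ring.
    + rewrite period_int_cos_Z by auto; ring.
Qed.

Lemma strip_boundary_mean d A B : strip_boundary d A B -> period_int B = 0.
Proof.
  intros [HA [HB [Hc _]]]. rewrite <- (Hc 0%Z). apply period_int_ext; intro x.
  rewrite !Rmult_0_l, cos_0, sin_0, cosh_0; ring.
Qed.

(** A holomorphic function that is real on both boundary lines is constant: when [B] is
   zero the relations say that the moments of [A], multiplied by [sinh (n d)], vanish. *)
Lemma strip_boundary_real_const d A : 0 < d -> periodic2pi A ->
  strip_boundary d A (fun _ => 0) -> forall x, A x = mean A.
Proof.
  intros Hd Hp [HA [_ [Hc Hs]]]. pose proof PI_RGT_0.
  assert (Hsh : forall n, (n <> 0)%nat -> 0 < sinh (IZR (Z.of_nat n) * d)).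
  { intros n Hn; apply sinh_pos, Rmult_lt_0_compat; auto. rewrite <- INR_IZR_INZ.
    apply lt_0_INR; lia. }
  assert (K : forall x, 1 * A x + (- mean A) * 1 = 0).
  { apply fourier_unique; [intro x; now rewrite Hp|cont| |]; intro n.
    - rewrite (period_int_lincomb (fun t => A t * cos (INR n * t)) (fun t => cos (INR n * t)) _ 1 (- mean A));
        cont; [|intro; ring].
      destruct n as [|n].
      + rewrite (period_int_ext _ A), (period_int_ext (fun t => cos _) (fun _ => 1)).
        * rewrite period_int_const, mean_period_int; field; lra.
        * intro; simpl; rewrite Rmult_0_l; apply cos_0.
        * intro; simpl; rewrite Rmult_0_l, cos_0; ring.
      + specialize (Hs (Z.of_nat (S n))). specialize (Hsh (S n) ltac:(lia)).
        rewrite (period_int_scal (fun x => A x * cos (INR (S n) * x)) _ (sinh (IZR (Z.of_nat (S n)) * d))) in Hs;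
          cont; [|intro; rewrite INR_IZR_INZ; ring].
        apply Rmult_integral in Hs. destruct Hs as [Hs|Hs]; [lra|]. rewrite Hs.
        rewrite (period_int_ext _ (fun t => cos (INR (S n) * t - 0))).
        * rewrite period_int_cos_phase by lia; ring.
        * intro; f_equal; ring.
    - rewrite (period_int_lincomb (fun t => A t * sin (INR n * t)) (fun t => sin (IZR (Z.of_nat n) * t)) _ 1 (- mean A));
        cont; [|intro; rewrite INR_IZR_INZ; ring].
      rewrite period_int_sin_Z. destruct n as [|n].
      + rewrite (period_int_ext _ (fun _ => 0)).
        * rewrite period_int_const; ring.
        * intro; simpl; rewrite Rmult_0_l, sin_0; ring.
      + specialize (Hc (Z.of_nat (S n))). specialize (Hsh (S n) ltac:(lia)).
        rewrite (period_int_scal (fun x => A x * sin (INR (S n) * x)) _ (- sinh (IZR (Z.of_nat (S n)) * d))) in Hc;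
          cont; [|intro; rewrite INR_IZR_INZ; ring].
        apply Rmult_integral in Hc. destruct Hc as [Hc|Hc]; [lra|]. rewrite Hc; ring. }
  intro x; specialize (K x); lra.
Qed.

(** The boundary functions which stay in the class when multiplied by any member of
   it.  In contrast to the closure of the class under products, this property
   passes from combinations of [cos (n (x + i d))] and [sin (n (x + i d))] to their uniform
   limits. *)
Definition multiplier (d : R) (C D : R -> R) : Prop :=
  cont C /\ cont D /\ forall A B, strip_boundary d A B ->
    strip_boundary d (fun x => A x * C x - B x * D x) (fun x => A x * D x + B x * C x).

Lemma multiplier_boundary d C D : multiplier d C D -> strip_boundary d C D.
Proof.
  intros [_ [_ H]]. apply (strip_boundary_ext d (fun x => 1 * C x - 0 * D x) (fun x => 1 * D x + 0 * C x)).
  - intro; ring.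
  - intro; ring.
  - apply (H (fun _ => 1) (fun _ => 0)), strip_boundary_one.
Qed.

Lemma multiplier_ext d C D C' D' : (forall x, C x = C' x) -> (forall x, D x = D' x) ->
  multiplier d C D -> multiplier d C' D'.
Proof.
  intros EC ED [HC [HD H]].
  split; [now apply (cont_ext C)|]. split; [now apply (cont_ext D)|].
  intros A B HAB. apply (strip_boundary_ext d _ _ _ _) with (3 := H A B HAB);
    intro; now rewrite EC, ED.
Qed.

Lemma multiplier_one d : multiplier d (fun _ => 1) (fun _ => 0).
Proof.
  split; [cont|]. split; [cont|]. intros A B HAB.
  apply (strip_boundary_ext d A B); auto; intro; ring.
Qed.

Lemma multiplier_lincomb d a C1 D1 b C2 D2 : multiplier d C1 D1 -> multiplier d C2 D2 ->
  multiplier d (fun x => a * C1 x + b * C2 x) (fun x => a * D1 x + b * D2 x).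
Proof.
  intros [HC1 [HD1 H1]] [HC2 [HD2 H2]]. split; [cont|]. split; [cont|].
  intros A B HAB.
  apply (strip_boundary_ext d _ _ _ _) with (3 := strip_boundary_lincomb d a _ _ b _ _ (H1 A B HAB) (H2 A B HAB));
    intro; ring.
Qed.

Lemma multiplier_sum d (C D : nat -> R -> R) N : (forall j, multiplier d (C j) (D j)) ->
  multiplier d (fun x => sum_n (fun j => C j x) N) (fun x => sum_n (fun j => D j x) N).
Proof.
  intros H; induction N as [|N IH].
  - apply (multiplier_ext d (C O) (D O)); auto; intro; now rewrite sum_O.
  - apply (multiplier_ext d _ _ _ _) with (3 := multiplier_lincomb d 1 _ _ 1 _ _ IH (H (S N)));
      intro; rewrite sum_Sn_R; ring.
Qed.

Lemma multiplier_lim d Cn Dn C D : (forall n, multiplier d (Cn n) (Dn n)) ->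
  unif_lim Cn C -> unif_lim Dn D -> multiplier d C D.
Proof.
  intros H LC LD.
  assert (HCn : forall n, cont (Cn n)) by apply H.
  assert (HDn : forall n, cont (Dn n)) by apply H.
  assert (HC : cont C) by (now apply (unif_lim_cont Cn)).
  assert (HD : cont D) by (now apply (unif_lim_cont Dn)).
  split; auto. split; auto. intros A B HAB.
  assert (HA : cont A) by apply HAB. assert (HB : cont B) by apply HAB.
  split; [cont|]. split; [cont|]. split; intro n.
  - rewrite <- (unif_lim_period_int_zero2 Dn D
      (fun x => A x * (cos (IZR n * x) * cosh (IZR n * d)) + B x * (sin (IZR n * x) * sinh (IZR n * d)))
      Cn C
      (fun x => B x * (cos (IZR n * x) * cosh (IZR n * d)) - A x * (sin (IZR n * x) * sinh (IZR n * d))));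
      auto; cont.
    + apply period_int_ext; intro; ring.
    + intro k. destruct (proj2 (proj2 (H k)) A B HAB) as [_ [_ [K _]]].
      rewrite <- (K n). apply period_int_ext; intro; ring.
  - rewrite <- (unif_lim_period_int_zero2 Dn D
      (fun x => A x * (sin (IZR n * x) * cosh (IZR n * d)) - B x * (cos (IZR n * x) * sinh (IZR n * d)))
      Cn C
      (fun x => B x * (sin (IZR n * x) * cosh (IZR n * d)) + A x * (cos (IZR n * x) * sinh (IZR n * d))));
      auto; cont.
    + apply period_int_ext; intro; ring.
    + intro k. destruct (proj2 (proj2 (H k)) A B HAB) as [_ [_ [_ K]]].
      rewrite <- (K n). apply period_int_ext; intro; ring.
Qed.

Lemma cosh_plus x y : cosh (x + y) = cosh x * cosh y + sinh x * sinh y.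
Proof. unfold cosh, sinh. rewrite Ropp_plus_distr, !exp_plus. field. Qed.

Lemma sinh_plus x y : sinh (x + y) = sinh x * cosh y + cosh x * sinh y.
Proof. unfold cosh, sinh. rewrite Ropp_plus_distr, !exp_plus. field. Qed.

Lemma cosh_minus x y : cosh (x - y) = cosh x * cosh y - sinh x * sinh y.
Proof. unfold Rminus, cosh, sinh. rewrite Ropp_plus_distr, !exp_plus, !Ropp_involutive. field. Qed.

Lemma sinh_minus x y : sinh (x - y) = sinh x * cosh y - cosh x * sinh y.
Proof. unfold Rminus, cosh, sinh. rewrite Ropp_plus_distr, !exp_plus, !Ropp_involutive. field. Qed.

Ltac addition_formulas :=
  rewrite ?plus_IZR, ?minus_IZR, ?Rmult_plus_distr_r, ?Rmult_minus_distr_r,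
    ?cos_plus, ?sin_plus, ?cos_minus, ?sin_minus, ?cosh_plus, ?sinh_plus, ?cosh_minus, ?sinh_minus.

(** The product of [cos (m (x + i d))] with [cos (n (x + i d))] or [sin (n (x + i d))] is
   half a sum of functions of the same form, with frequencies [m + n] and [m - n]. *)
Lemma multiplier_cos d m :
  multiplier d (fun x => cos (IZR m * x) * cosh (IZR m * d)) (fun x => - (sin (IZR m * x) * sinh (IZR m * d))).
Proof.
  split; [cont|]. split; [cont|]. intros A B [HA [HB [Hc Hs]]].
  split; [cont|]. split; [cont|]. split; intro n.
  - rewrite (period_int_lincomb
      (fun x => B x * (cos (IZR (m + n) * x) * cosh (IZR (m + n) * d))
                   - A x * (sin (IZR (m + n) * x) * sinh (IZR (m + n) * d)))
      (fun x => B x * (cos (IZR (m - n) * x) * cosh (IZR (m - n) * d))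
                   - A x * (sin (IZR (m - n) * x) * sinh (IZR (m - n) * d)))
      _ (1/2) (1/2)); cont.
    + rewrite !Hc; ring.
    + intro x; addition_formulas; field.
  - rewrite (period_int_lincomb
      (fun x => B x * (sin (IZR (m + n) * x) * cosh (IZR (m + n) * d))
                   + A x * (cos (IZR (m + n) * x) * sinh (IZR (m + n) * d)))
      (fun x => B x * (sin (IZR (m - n) * x) * cosh (IZR (m - n) * d))
                   + A x * (cos (IZR (m - n) * x) * sinh (IZR (m - n) * d)))
      _ (1/2) (-1/2)); cont.
    + rewrite !Hs; ring.
    + intro x; addition_formulas; field.
Qed.

Lemma multiplier_sin d m :
  multiplier d (fun x => sin (IZR m * x) * cosh (IZR m * d)) (fun x => cos (IZR m * x) * sinh (IZR m * d)).
Proof.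
  split; [cont|]. split; [cont|]. intros A B [HA [HB [Hc Hs]]].
  split; [cont|]. split; [cont|]. split; intro n.
  - rewrite (period_int_lincomb
      (fun x => B x * (sin (IZR (m + n) * x) * cosh (IZR (m + n) * d))
                   + A x * (cos (IZR (m + n) * x) * sinh (IZR (m + n) * d)))
      (fun x => B x * (sin (IZR (m - n) * x) * cosh (IZR (m - n) * d))
                   + A x * (cos (IZR (m - n) * x) * sinh (IZR (m - n) * d)))
      _ (1/2) (1/2)); cont.
    + rewrite !Hs; ring.
    + intro x; addition_formulas; field.
  - rewrite (period_int_lincomb
      (fun x => B x * (cos (IZR (m + n) * x) * cosh (IZR (m + n) * d))
                   - A x * (sin (IZR (m + n) * x) * sinh (IZR (m + n) * d)))
      (fun x => B x * (cos (IZR (m - n) * x) * cosh (IZR (m - n) * d))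
                   - A x * (sin (IZR (m - n) * x) * sinh (IZR (m - n) * d)))
      _ (-1/2) (1/2)); cont.
    + rewrite !Hc; ring.
    + intro x; addition_formulas; field.
Qed.

Lemma unif_lim_const_plus c fn f : unif_lim fn f -> unif_lim (fun n x => c + fn n x) (fun x => c + f x).
Proof.
  intros H e He; destruct (H e He) as [N HN]; exists N; intros n Hn x.
  replace (c + fn n x - (c + f x)) with (fn n x - f x) by ring; auto.
Qed.

(** The term of frequency [n] of the two series is
   [(a_n sin (n (x + i d)) - b_n cos (n (x + i d))) / sinh (n d)], where [a_n] and [b_n] are
   the Fourier coefficients of [w]. *)
Lemma multiplier_hilbert d c w : 0 < d -> holder_fun w -> mean w = 0 ->
  multiplier d (fun x => c + strip_hilbert d w x) w.
Proof.
  intros Hd Hw Hm.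
  apply (multiplier_lim d (fun N x => c + hilbert_sum d w N x) (fourier_sum w)).
  - intro N.
    apply (multiplier_ext d
      (fun x => c * 1 + 1 * hilbert_sum d w N x) (fun x => c * 0 + 1 * fourier_sum w N x));
      try (intro; ring).
    apply (multiplier_lincomb d c (fun _ => 1) (fun _ => 0) 1); [apply multiplier_one|].
    unfold hilbert_sum, fourier_sum.
    apply (multiplier_sum d (fun j x => coth (INR (S j) * d) *
      (fourier_cos w (S j) * sin (INR (S j) * x) - fourier_sin w (S j) * cos (INR (S j) * x)))
      (fun j x => fourier_term 0 w (S j) x)).
    intro j. set (n := S j).
    assert (Hs : 0 < sinh (INR n * d)).
    { apply sinh_pos, Rmult_lt_0_compat; auto. apply lt_0_INR; unfold n; lia. }
    apply (multiplier_ext d _ _ _ _) with (3 := multiplier_lincomb d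
      (fourier_cos w n / sinh (INR n * d)) _ _ (- fourier_sin w n / sinh (INR n * d)) _ _
      (multiplier_sin d (Z.of_nat n)) (multiplier_cos d (Z.of_nat n))); intro x.
    + rewrite <- INR_IZR_INZ. unfold coth. field; lra.
    + rewrite <- INR_IZR_INZ, fourier_term_0. field; lra.
  - now apply unif_lim_const_plus, hilbert_sum_lim.
  - now apply fourier_sum_lim.
Qed.

(** Subtracting the boundary function [strip_hilbert d B + i B] leaves a real one. *)
Lemma strip_boundary_conjugate d A B : 0 < d -> periodic2pi A -> holder_fun B ->
  strip_boundary d A B -> forall x, A x = mean A - mean (strip_hilbert d B) + strip_hilbert d B x.
Proof.
  intros Hd Hp HB HAB x.
  assert (Hm : mean B = 0).
  { rewrite mean_period_int, (strip_boundary_mean d A B HAB). unfold Rdiv; ring. }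
  assert (M := multiplier_boundary _ _ _ (multiplier_hilbert d 0 B Hd HB Hm)).
  assert (CA : cont A) by apply HAB.
  assert (CH := strip_hilbert_cont d B Hd HB).
  assert (K := strip_boundary_real_const d (fun x => A x - strip_hilbert d B x) Hd).
  rewrite !mean_period_int in *. rewrite period_int_minus in K by auto.
  assert (E : A x - strip_hilbert d B x = (period_int A - period_int (strip_hilbert d B)) / (2 * PI)).
  { apply K.
    - intro y; now rewrite Hp, strip_hilbert_periodic.
    - apply (strip_boundary_ext d _ _ _ _) with (3 := strip_boundary_lincomb d 1 _ _ (-1) _ _ HAB M);
        intro; ring. }
  unfold Rdiv in *. lra.
Qed.

Lemma strip_hilbert_mean d w : 0 < d -> holder_fun w -> period_int (strip_hilbert d w) = 0.
Proof.
  intros Hd Hw.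
  assert (L := unif_lim_period_int _ _ (fun _ => 1) (hilbert_sum_cont d w) (strip_hilbert_cont d w Hd Hw)
                 (cont_const 1) (hilbert_sum_lim d w Hd Hw)).
  cbv beta in L.
  rewrite (period_int_ext (fun x => strip_hilbert d w x * 1) (strip_hilbert d w)) in L by (intro; ring).
  apply (is_lim_seq_ext _ (fun _ => 0)) in L.
  - apply is_lim_seq_unique in L. rewrite Lim_seq_const in L. injection L; auto.
  - intro N. rewrite (period_int_ext _ (hilbert_sum d w N)) by (intro; ring). unfold hilbert_sum.
    rewrite (period_int_sum (fun j x => coth (INR (S j) * d) *
      (fourier_cos w (S j) * sin (INR (S j) * x) - fourier_sin w (S j) * cos (INR (S j) * x))))
      by (intro; cont).
    rewrite (sum_n_ext _ (fun _ => 0)); [rewrite sum_n_const; ring|]. intro j.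
    rewrite (period_int_lincomb (fun x => sin (IZR (Z.of_nat (S j)) * x))
      (fun x => cos (IZR (Z.of_nat (S j)) * x)) _ (coth (INR (S j) * d) * fourier_cos w (S j))
      (- coth (INR (S j) * d) * fourier_sin w (S j))); cont.
    + rewrite period_int_sin_Z, period_int_cos_Z by lia; eq_in_R; ring.
    + intro; rewrite INR_IZR_INZ; ring.
Qed.

(** * Functions on the closed strip *)

Definition clamp (d y : R) : R := Rmax (- d) (Rmin y 0).

Lemma clamp_in d y : 0 < d -> - d <= clamp d y <= 0.
Proof.
  intros Hd; unfold clamp, Rmax, Rmin.
  destruct (Rle_dec y 0);
    repeat match goal with |- context [Rle_dec ?a ?b] => destruct (Rle_dec a b) end; lra.
Qed.

Lemma clamp_id d y : - d <= y <= 0 -> clamp d y = y.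
Proof.
  intros Hy; unfold clamp, Rmax, Rmin.
  destruct (Rle_dec y 0);
    repeat match goal with |- context [Rle_dec ?a ?b] => destruct (Rle_dec a b) end; lra.
Qed.

Lemma clamp_lipschitz d y z : Rabs (clamp d y - clamp d z) <= Rabs (y - z).
Proof.
  unfold clamp, Rmax, Rmin.
  destruct (Rle_dec y 0), (Rle_dec z 0);
    repeat match goal with |- context [Rle_dec ?a ?b] => destruct (Rle_dec a b) end;
    unfold Rabs; repeat match goal with |- context [Rcase_abs ?a] => destruct (Rcase_abs a) end; lra.
Qed.

(** Continuity on the closed strip, as continuity on the plane of the extension
   that is constant on vertical half-lines outside the strip. *)
Definition cont_strip (d : R) (A : R -> R -> R) : Prop :=
  forall x y, continuity_2d_pt (fun u v => A u (clamp d v)) x y.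

Lemma continuity_2d_swap f x y : continuity_2d_pt f x y -> continuity_2d_pt (fun u v => f v u) y x.
Proof.
  intros H e; destruct (H e) as [del Hd]; exists del; intros u v Hu Hv; now apply Hd.
Qed.

Lemma continuity_2d_slice_x f x y : continuity_2d_pt f x y -> continuous (fun t => f t y) x.
Proof.
  intros H. apply filterlim_locally; intros e. destruct (H e) as [del Hd].
  exists del; intros t Ht. apply Hd; auto. rewrite Rminus_diag, Rabs_R0; apply cond_pos.
Qed.

Lemma continuity_2d_slice_y f x y : continuity_2d_pt f x y -> continuous (fun t => f x t) y.
Proof. intros H; now apply (continuity_2d_slice_x (fun u v => f v u)), continuity_2d_swap. Qed.

Lemma continuity_2d_pt_fst (f : R -> R) x y : cont f -> continuity_2d_pt (fun u _ => f u) x y.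
Proof.
  intros Hf e. destruct (cont_eps f x e Hf (cond_pos e)) as [del [Hd H]].
  exists (mkposreal del Hd); intros u v Hu _; now apply H.
Qed.

Lemma continuity_2d_pt_snd (f : R -> R) x y : cont f -> continuity_2d_pt (fun _ v => f v) x y.
Proof. intros Hf. apply (continuity_2d_swap (fun u _ => f u)), continuity_2d_pt_fst, Hf. Qed.

Ltac cont2 :=
  repeat match goal with
  | |- continuity_2d_pt (fun u v => _ + _) _ _ => apply continuity_2d_pt_plus
  | |- continuity_2d_pt (fun u v => _ - _) _ _ => apply continuity_2d_pt_minus
  | |- continuity_2d_pt (fun u v => _ * _) _ _ => apply continuity_2d_pt_mult
  | |- continuity_2d_pt (fun u v => - _) _ _ => apply continuity_2d_pt_opp
  end; auto.

Lemma cont_clamp d : cont (clamp d).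
Proof.
  apply cont_of_eps; intros x e He; exists e; split; auto; intros y Hy.
  eapply Rle_lt_trans; [apply clamp_lipschitz|auto].
Qed.

Lemma cont_strip_slice d A y : - d <= y <= 0 -> cont_strip d A -> cont (fun x => A x y).
Proof.
  intros Hy H x. rewrite <- (clamp_id d y Hy).
  apply (continuity_2d_slice_x (fun u v => A u (clamp d v)) x y), H.
Qed.

Lemma cont_strip_slice_y d A x : cont_strip d A -> cont (fun y => A x (clamp d y)).
Proof. intros H y. apply (continuity_2d_slice_y (fun u v => A u (clamp d v)) x y), H. Qed.

Lemma locally_2d_strip d x y (P : R -> R -> Prop) : - d < y < 0 ->
  (forall u v, - d < v < 0 -> P u v) -> locally_2d P x y.
Proof.
  intros Hy H. assert (He : 0 < Rmin (y + d) (- y)) by (apply Rmin_glb_lt; lra).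
  exists (mkposreal _ He); intros u v _ Hv. apply H. simpl in Hv.
  pose proof (Rmin_l (y + d) (- y)). pose proof (Rmin_r (y + d) (- y)).
  apply Rabs_def2 in Hv. lra.
Qed.

Lemma locally_strip d y (P : R -> Prop) : - d < y < 0 ->
  (forall v, - d < v < 0 -> P v) -> locally y P.
Proof.
  intros Hy H. assert (He : 0 < Rmin (y + d) (- y)) by (apply Rmin_glb_lt; lra).
  exists (mkposreal _ He); intros v Hv. apply H.
  change (Rabs (v - y) < Rmin (y + d) (- y)) in Hv.
  pose proof (Rmin_l (y + d) (- y)). pose proof (Rmin_r (y + d) (- y)).
  apply Rabs_def2 in Hv. lra.
Qed.

Lemma cont_strip_interior d A x y : - d < y < 0 -> cont_strip d A -> continuity_2d_pt A x y.
Proof.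
  intros Hy H. apply continuity_2d_pt_ext_loc with (2 := H x y).
  apply (locally_2d_strip d); auto; intros u v Hv. rewrite clamp_id; lra.
Qed.

Lemma locally_2d_swap P x y : locally_2d P x y -> locally_2d (fun u v => P v u) y x.
Proof. intros [del H]; exists del; intros u v Hu Hv; now apply H. Qed.

(** Identities between the gradient and the potential are first obtained inside the
   strip; this carries them to the boundary lines. *)
Lemma strip_closure d (F : R -> R) : 0 < d -> cont F -> (forall y, - d < y < 0 -> F y = 0) ->
  forall y, - d <= y <= 0 -> F y = 0.
Proof.
  intros Hd HF H y Hy. apply cond_eq; intros e He.
  destruct (cont_eps F y e HF He) as [del [Hdel Hn]].
  (* a point of the open interval within [del] of [y] *)
  pose (t := Rmin (1 / 2) (del / (2 * d))).
  assert (Ht : 0 < t) by (apply Rmin_glb_lt; [lra|apply Rdiv_lt_0_compat; lra]).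
  assert (Ht1 : t <= 1 / 2) by apply Rmin_l.
  assert (Ht2 : t * d <= del / 2).
  { apply Rle_trans with (del / (2 * d) * d); [|right; field; lra].
    apply Rmult_le_compat_r; [lra|apply Rmin_r]. }
  specialize (Hn (y + t * (- d / 2 - y))).
  rewrite (H (y + t * (- d / 2 - y))) in Hn by nra.
  rewrite <- Rabs_Ropp. replace (- (F y - 0)) with (0 - F y) by ring.
  apply Hn. apply Rabs_def1; nra.
Qed.

Lemma RInt_strip_cont d A a b : a <= b -> 0 < d -> cont_strip d A ->
  cont (fun y => RInt (fun x => A x (clamp d y)) a b).
Proof.
  intros Hab Hd H. apply cont_of_eps; intros c e He.
  assert (He' : 0 < e / (2 * (b - a + 1))) by (apply Rdiv_lt_0_compat; lra).
  destruct (uniform_continuity_2d_1d (fun u v => A u (clamp d v)) a b c (fun x _ => H x c)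
              (mkposreal _ He')) as [del Hdel]. simpl in Hdel.
  exists del; split; [apply cond_pos|]. intros y Hy.
  assert (C : forall z, cont (fun x => A x (clamp d z))).
  { intro z; apply (cont_strip_slice d); auto; now apply clamp_in. }
  replace (RInt (fun x => A x (clamp d y)) a b - RInt (fun x => A x (clamp d c)) a b)
    with (1 * RInt (fun x => A x (clamp d y)) a b + -1 * RInt (fun x => A x (clamp d c)) a b) by ring.
  rewrite <- RInt_lincomb by auto.
  apply Rle_lt_trans with ((b - a) * (e / (2 * (b - a + 1)))).
  - apply abs_RInt_le_const; auto.
    + pose proof (C y). pose proof (C c). apply cont_ex_RInt. cont.
    + intros x Hx. replace (1 * A x (clamp d y) + -1 * A x (clamp d c))
        with (A x (clamp d y) - A x (clamp d c)) by ring.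
      pose proof (cond_pos del). apply Rabs_def2 in Hy.
      left; apply (Hdel x c x y); try lra. rewrite Rminus_diag, Rabs_R0; lra.
  - apply Rle_lt_trans with (e / 2); [|lra].
    apply Rle_trans with ((b - a + 1) * (e / (2 * (b - a + 1)))); [|right; field; lra].
    apply Rmult_le_compat_r; lra.
Qed.

(** Conservation law: since [F_y = P_x] with [P] periodic in [x], the derivative in
   [y] of the flux of [F] vanishes inside the strip, and the flux is continuous up to
   the boundary lines. *)
Lemma strip_conservation d (F P D : R -> R -> R) : 0 < d -> cont_strip d F ->
  (forall x y : R, - d < y < 0 -> is_derive (fun t => F x t) y (D x y)) ->
  (forall x y : R, - d < y < 0 -> is_derive (fun t => P t y) x (D x y)) ->
  (forall x y : R, - d < y < 0 -> continuity_2d_pt D x y) ->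
  (forall x y : R, - d < y < 0 -> P (x + 2 * PI) y = P x y) ->
  period_int (fun x => F x 0) = period_int (fun x => F x (- d)).
Proof.
  intros Hd HF DF DP HD Pp. pose proof PI_RGT_0.
  pose (I := fun y => period_int (fun x => F x (clamp d y))).
  assert (HI : cont I) by (apply RInt_strip_cont; auto; lra).
  assert (DI : forall y, - d < y < 0 -> is_derive I y 0).
  { intros y Hy.
    assert (ED : forall t u, - d < u < 0 -> Derive (fun z => F t z) u = D t u).
    { intros t u Hu; apply is_derive_unique, DF, Hu. }
    apply is_derive_ext_loc with (fun y => RInt (fun x => F x y) (- PI) PI).
    { apply (locally_strip d); auto; intros v Hv. unfold I; rewrite clamp_id by lra. reflexivity. }
    assert (E0 : RInt (fun x => Derive (fun u => F x u) y) (- PI) PI = 0).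
    { rewrite (RInt_ext _ (fun x => D x y)) by (intros; apply ED; auto).
      apply (period_int_derive (fun x => P x y)).
      - intro x; now apply DP.
      - intro x; apply (continuity_2d_slice_x D), HD, Hy.
      - rewrite <- (Pp (- PI) y Hy); f_equal; ring. }
    rewrite <- E0.
    apply (is_derive_RInt_param (fun y x => F x y) (- PI) PI y).
    - apply (locally_strip d); auto; intros v Hv t _. exists (D t v); now apply DF.
    - intros t _. apply continuity_2d_pt_ext_loc with (fun u v => D v u).
      + apply (locally_2d_swap (fun u v => D u v = Derive (fun z => F u z) v)).
        apply (locally_2d_strip d); auto; intros; now rewrite ED.
      + apply continuity_2d_swap, HD, Hy.
    - apply (locally_strip d); auto; intros v Hv. apply (ex_RInt_continuous (V := R_CompleteNormedModule)).
      intros x _; apply (cont_strip_slice d F v); auto; lra. }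
  destruct (MVT_gen I (- d) 0 (fun _ => 0)) as [c [_ Hc]].
  - intros x Hx. rewrite Rmin_left, Rmax_right in Hx by lra. now apply DI.
  - intros x _; apply continuity_pt_filterlim, HI.
  - unfold I in Hc. rewrite !clamp_id in Hc by lra. lra.
Qed.

(** * Holomorphic functions in the strip *)

(** [A + i B] is holomorphic in [x + i y] inside the strip, with derivative
   [P + i Q], continuous up to the boundary lines, and periodic in [x]. *)
Definition holomorphic_strip (d : R) (A B P Q : R -> R -> R) : Prop :=
  cont_strip d A /\ cont_strip d B /\
  forall x y : R, - d < y < 0 ->
    (is_derive (fun t => A t y) x (P x y) /\ is_derive (fun t => A x t) y (- Q x y) /\
     is_derive (fun t => B t y) x (Q x y) /\ is_derive (fun t => B x t) y (P x y)) /\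
    (continuity_2d_pt P x y /\ continuity_2d_pt Q x y) /\
    (A (x + 2 * PI) y = A x y /\ B (x + 2 * PI) y = B x y).

Lemma holomorphic_mult d A1 B1 P1 Q1 A2 B2 P2 Q2 :
  holomorphic_strip d A1 B1 P1 Q1 -> holomorphic_strip d A2 B2 P2 Q2 ->
  holomorphic_strip d (fun x y => A1 x y * A2 x y - B1 x y * B2 x y)
    (fun x y => A1 x y * B2 x y + B1 x y * A2 x y)
    (fun x y => (P1 x y * A2 x y - Q1 x y * B2 x y) + (A1 x y * P2 x y - B1 x y * Q2 x y))
    (fun x y => (P1 x y * B2 x y + Q1 x y * A2 x y) + (A1 x y * Q2 x y + B1 x y * P2 x y)).
Proof.
  intros [CA1 [CB1 H1]] [CA2 [CB2 H2]].
  split; [intros x y; specialize (CA1 x y); specialize (CA2 x y); specialize (CB1 x y);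
          specialize (CB2 x y); cont2|].
  split; [intros x y; specialize (CA1 x y); specialize (CA2 x y); specialize (CB1 x y);
          specialize (CB2 x y); cont2|].
  intros x y Hy.
  destruct (H1 x y Hy) as [[D1 [D2 [D3 D4]]] [[C1 C2] [E1 E2]]].
  destruct (H2 x y Hy) as [[D5 [D6 [D7 D8]]] [[C3 C4] [E3 E4]]].
  assert (KA1 := cont_strip_interior d A1 x y Hy CA1).
  assert (KA2 := cont_strip_interior d A2 x y Hy CA2).
  assert (KB1 := cont_strip_interior d B1 x y Hy CB1).
  assert (KB2 := cont_strip_interior d B2 x y Hy CB2).
  split; [|split; [split; cont2|rewrite E1, E2, E3, E4; auto]].
  refine (conj _ (conj _ (conj _ _))); auto_derive;
    try (repeat apply conj; try exact I; eexists; eassumption);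
    repeat match goal with
    | H : is_derive ?f ?x ?l |- context [Derive ?g ?x] =>
        replace (Derive g x) with l by (symmetry; apply is_derive_unique; exact H); clear H
    end; ring.
Qed.

(** The derivative of [1 / F] is [- F' / F ^ 2], with [F = A + i B] and [F' = P + i Q]. *)
Lemma holomorphic_inv d A B P Q : 0 < d -> holomorphic_strip d A B P Q ->
  (forall x y : R, - d <= y <= 0 -> A x y ^ 2 + B x y ^ 2 <> 0) ->
  holomorphic_strip d (fun x y => A x y / (A x y ^ 2 + B x y ^ 2))
    (fun x y => - B x y / (A x y ^ 2 + B x y ^ 2))
    (fun x y => - (P x y * (A x y ^ 2 - B x y ^ 2) + Q x y * (2 * A x y * B x y))
                / (A x y ^ 2 + B x y ^ 2) ^ 2)
    (fun x y => - (Q x y * (A x y ^ 2 - B x y ^ 2) - P x y * (2 * A x y * B x y))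
                / (A x y ^ 2 + B x y ^ 2) ^ 2).
Proof.
  intros Hd [CA [CB H]] Hne.
  assert (Hcl : forall u v, A u (clamp d v) ^ 2 + B u (clamp d v) ^ 2 <> 0).
  { intros u v; apply Hne; now apply clamp_in. }
  assert (CN : forall x y, continuity_2d_pt (fun u v => A u (clamp d v) ^ 2 + B u (clamp d v) ^ 2) x y).
  { intros x y. specialize (CA x y). specialize (CB x y). simpl.
    cont2; apply continuity_2d_pt_const. }
  split; [|split].
  - intros x y. unfold Rdiv. apply continuity_2d_pt_mult; [apply CA|].
    apply (continuity_2d_pt_inv (fun u v => A u (clamp d v) ^ 2 + B u (clamp d v) ^ 2)); auto.
  - intros x y. unfold Rdiv. apply continuity_2d_pt_mult; [apply continuity_2d_pt_opp, CB|].
    apply (continuity_2d_pt_inv (fun u v => A u (clamp d v) ^ 2 + B u (clamp d v) ^ 2)); auto.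
  - intros x y Hy. specialize (Hne x y ltac:(lra)).
    destruct (H x y Hy) as [[D1 [D2 [D3 D4]]] [[C1 C2] [E1 E2]]].
    assert (KA := cont_strip_interior d A x y Hy CA).
    assert (KB := cont_strip_interior d B x y Hy CB).
    assert (Hne2 : (A x y ^ 2 + B x y ^ 2) ^ 2 <> 0) by (now apply pow_nonzero).
    split; [|split; [|rewrite E1, E2; auto]].
    + refine (conj _ (conj _ (conj _ _))); auto_derive;
        try (repeat apply conj; try exact I; try (eexists; eassumption); simpl in Hne; exact Hne);
        repeat match goal with
        | H : is_derive ?f ?x ?l |- context [Derive ?g ?x] =>
            replace (Derive g x) with l by (symmetry; apply is_derive_unique; exact H); clear H
        end; field; repeat split; auto; simpl in Hne; intro; apply Hne; lra.
    + split; unfold Rdiv; apply continuity_2d_pt_mult.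
      * simpl; cont2; apply continuity_2d_pt_const.
      * apply (continuity_2d_pt_inv (fun u v => (A u v ^ 2 + B u v ^ 2) ^ 2)); auto.
        simpl; cont2; apply continuity_2d_pt_const.
      * simpl; cont2; apply continuity_2d_pt_const.
      * apply (continuity_2d_pt_inv (fun u v => (A u v ^ 2 + B u v ^ 2) ^ 2)); auto.
        simpl; cont2; apply continuity_2d_pt_const.
Qed.

Lemma sinh_is_derive x : is_derive sinh x (cosh x).
Proof. apply is_derive_Reals, derivable_pt_lim_sinh. Qed.

Lemma cosh_is_derive x : is_derive cosh x (sinh x).
Proof. apply is_derive_Reals, derivable_pt_lim_cosh. Qed.

Lemma cont_sinh : cont sinh.
Proof. exact (is_derive_cont sinh cosh sinh_is_derive). Qed.

Lemma cont_cosh : cont cosh.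
Proof. exact (is_derive_cont cosh sinh cosh_is_derive). Qed.

Lemma is_derive_affine (f : R -> R) l n a x : is_derive f (n * (x + a)) l ->
  is_derive (fun t => f (n * (t + a))) x (n * l).
Proof.
  intros H. apply (is_derive_comp f (fun t => n * (t + a)) x l n H). auto_derive; auto; ring.
Qed.

Lemma cont_affine f n a : cont f -> cont (fun t => f (n * (t + a))).
Proof. intros Hf; apply (cont_comp (fun t => n * (t + a)) f); cont. Qed.

Lemma continuity_2d_tensor f g x y : cont f -> cont g -> continuity_2d_pt (fun u v => f u * g v) x y.
Proof.
  intros Hf Hg; apply continuity_2d_pt_mult; [now apply continuity_2d_pt_fst|now apply continuity_2d_pt_snd].
Qed.

Lemma cos_mul_period n x : cos (IZR n * (x + 2 * PI)) = cos (IZR n * x).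
Proof.
  replace (IZR n * (x + 2 * PI)) with (IZR n * x + IZR n * PI + IZR n * PI) by ring.
  rewrite !cos_plus, !sin_plus, sin_mul_PI.
  assert (H := sin2_cos2 (IZR n * PI)). rewrite sin_mul_PI in H. unfold Rsqr in H.
  transitivity (cos (IZR n * x) * (cos (IZR n * PI) * cos (IZR n * PI))); [ring|].
  replace (cos (IZR n * PI) * cos (IZR n * PI)) with 1 by lra. ring.
Qed.

Lemma sin_mul_period n x : sin (IZR n * (x + 2 * PI)) = sin (IZR n * x).
Proof.
  replace (IZR n * (x + 2 * PI)) with (IZR n * x + IZR n * PI + IZR n * PI) by ring.
  rewrite !sin_plus, !cos_plus, sin_mul_PI.
  assert (H := sin2_cos2 (IZR n * PI)). rewrite sin_mul_PI in H. unfold Rsqr in H.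
  transitivity (sin (IZR n * x) * (cos (IZR n * PI) * cos (IZR n * PI))); [ring|].
  replace (cos (IZR n * PI) * cos (IZR n * PI)) with 1 by lra. ring.
Qed.

Lemma is_derive_tensor_x (f : R -> R) l c x : is_derive f x l -> is_derive (fun t => f t * c) x (l * c).
Proof. intros H. auto_derive; [now exists l|]. replace (Derive (fun x0 : R => f x0) x) with l
  by (symmetry; now apply is_derive_unique). ring. Qed.

Lemma is_derive_tensor_y (f : R -> R) l c x : is_derive f x l -> is_derive (fun t => c * f t) x (c * l).
Proof. intros H. auto_derive; [now exists l|]. replace (Derive (fun x0 : R => f x0) x) with l
  by (symmetry; now apply is_derive_unique). ring. Qed.

Lemma holomorphic_cos d n : holomorphic_strip d
  (fun x y => cos (IZR n * x) * cosh (IZR n * (y + d)))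
  (fun x y => (- sin (IZR n * x)) * sinh (IZR n * (y + d)))
  (fun x y => (- IZR n * sin (IZR n * x)) * cosh (IZR n * (y + d)))
  (fun x y => (- IZR n * cos (IZR n * x)) * sinh (IZR n * (y + d))).
Proof.
  assert (Cch : cont (fun y => cosh (IZR n * (y + d)))) by (apply cont_affine, cont_cosh).
  assert (Csh : cont (fun y => sinh (IZR n * (y + d)))) by (apply cont_affine, cont_sinh).
  assert (Kch : cont (fun y => cosh (IZR n * (clamp d y + d))))
    by (apply (cont_comp (clamp d) (fun y => cosh (IZR n * (y + d)))); auto using cont_clamp).
  assert (Ksh : cont (fun y => sinh (IZR n * (clamp d y + d))))
    by (apply (cont_comp (clamp d) (fun y => sinh (IZR n * (y + d)))); auto using cont_clamp).
  split; [|split].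
  - intros x y. apply (continuity_2d_tensor (fun u => cos (IZR n * u)) _ x y); cont.
  - intros x y. apply (continuity_2d_tensor (fun u => - sin (IZR n * u)) _ x y); cont.
  - intros x y _. rewrite cos_mul_period, sin_mul_period. split; [|split; [|auto]].
    + refine (conj _ (conj _ (conj _ _))).
      * apply is_derive_tensor_x. auto_derive; auto; ring.
      * replace (- (- IZR n * cos (IZR n * x) * sinh (IZR n * (y + d))))
          with (cos (IZR n * x) * (IZR n * sinh (IZR n * (y + d)))) by ring.
        apply is_derive_tensor_y, is_derive_affine, cosh_is_derive.
      * apply is_derive_tensor_x. auto_derive; auto; ring.
      * replace (- IZR n * sin (IZR n * x) * cosh (IZR n * (y + d)))
          with (- sin (IZR n * x) * (IZR n * cosh (IZR n * (y + d)))) by ring.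
        apply is_derive_tensor_y, is_derive_affine, sinh_is_derive.
    + split.
      * apply (continuity_2d_tensor (fun u => - IZR n * sin (IZR n * u)) _ x y); cont.
      * apply (continuity_2d_tensor (fun u => - IZR n * cos (IZR n * u)) _ x y); cont.
Qed.

Lemma holomorphic_sin d n : holomorphic_strip d
  (fun x y => sin (IZR n * x) * cosh (IZR n * (y + d)))
  (fun x y => cos (IZR n * x) * sinh (IZR n * (y + d)))
  (fun x y => (IZR n * cos (IZR n * x)) * cosh (IZR n * (y + d)))
  (fun x y => (- IZR n * sin (IZR n * x)) * sinh (IZR n * (y + d))).
Proof.
  assert (Cch : cont (fun y => cosh (IZR n * (y + d)))) by (apply cont_affine, cont_cosh).
  assert (Csh : cont (fun y => sinh (IZR n * (y + d)))) by (apply cont_affine, cont_sinh).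
  assert (Kch : cont (fun y => cosh (IZR n * (clamp d y + d))))
    by (apply (cont_comp (clamp d) (fun y => cosh (IZR n * (y + d)))); auto using cont_clamp).
  assert (Ksh : cont (fun y => sinh (IZR n * (clamp d y + d))))
    by (apply (cont_comp (clamp d) (fun y => sinh (IZR n * (y + d)))); auto using cont_clamp).
  split; [|split].
  - intros x y. apply (continuity_2d_tensor (fun u => sin (IZR n * u)) _ x y); cont.
  - intros x y. apply (continuity_2d_tensor (fun u => cos (IZR n * u)) _ x y); cont.
  - intros x y _. rewrite cos_mul_period, sin_mul_period. split; [|split; [|auto]].
    + refine (conj _ (conj _ (conj _ _))).
      * apply is_derive_tensor_x. auto_derive; auto; ring.
      * replace (- (- IZR n * sin (IZR n * x) * sinh (IZR n * (y + d))))
          with (sin (IZR n * x) * (IZR n * sinh (IZR n * (y + d)))) by ring.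
        apply is_derive_tensor_y, is_derive_affine, cosh_is_derive.
      * apply is_derive_tensor_x. auto_derive; auto; ring.
      * replace (IZR n * cos (IZR n * x) * cosh (IZR n * (y + d)))
          with (cos (IZR n * x) * (IZR n * cosh (IZR n * (y + d)))) by ring.
        apply is_derive_tensor_y, is_derive_affine, sinh_is_derive.
    + split.
      * apply (continuity_2d_tensor (fun u => IZR n * cos (IZR n * u)) _ x y); cont.
      * apply (continuity_2d_tensor (fun u => - IZR n * sin (IZR n * u)) _ x y); cont.
Qed.

Lemma holomorphic_flux d A B P Q : 0 < d -> holomorphic_strip d A B P Q ->
  period_int (fun x => B x 0) = period_int (fun x => B x (- d)).
Proof.
  intros Hd [CA [CB H]].
  apply (strip_conservation d B A P); auto; intros x y Hy; destruct (H x y Hy) as [? [? ?]]; tauto.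
Qed.

(** The flux is conserved for the products of [A + i B] with [cos (n (x + i (y + d)))] and
   [sin (n (x + i (y + d)))], all real on the line [y = - d]. *)
Lemma holomorphic_strip_boundary d A B P Q : 0 < d -> holomorphic_strip d A B P Q ->
  (forall x, B x (- d) = 0) -> strip_boundary d (fun x => A x 0) (fun x => B x 0).
Proof.
  intros Hd H HB.
  split; [apply (cont_strip_slice d); [lra|apply H]|].
  split; [apply (cont_strip_slice d); [lra|apply H]|].
  split; intro n.
  - assert (K := holomorphic_flux _ _ _ _ _ Hd (holomorphic_mult _ _ _ _ _ _ _ _ _ H (holomorphic_cos d n))).
    simpl in K. rewrite (period_int_ext (fun x => _ + B x (- d) * _) (fun _ => 0)) in K.
    + rewrite period_int_const, Rmult_0_r in K. etransitivity; [|exact K]. apply period_int_ext; intro x.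
      rewrite Rplus_0_l; ring.
    + intro x. rewrite HB, Rplus_opp_l, Rmult_0_r, sinh_0; ring.
  - assert (K := holomorphic_flux _ _ _ _ _ Hd (holomorphic_mult _ _ _ _ _ _ _ _ _ H (holomorphic_sin d n))).
    simpl in K. rewrite (period_int_ext (fun x => _ + B x (- d) * _) (fun _ => 0)) in K.
    + rewrite period_int_const, Rmult_0_r in K. etransitivity; [|exact K]. apply period_int_ext; intro x.
      rewrite Rplus_0_l; ring.
    + intro x. rewrite HB, Rplus_opp_l, Rmult_0_r, sinh_0; ring.
Qed.

(** * The gradient of the harmonic extension *)

Lemma holder_cont_strip a d (f : R * R -> R) : 0 < d -> 0 < a ->
  holder_on a (closed_strip d) f -> cont_strip d (fun x y => f (x, y)).
Proof.
  intros Hd Ha [K HK] x y e.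
  set (K' := Rabs K + 1). assert (HK' : 0 < K') by (unfold K'; pose proof (Rabs_pos K); lra).
  assert (Hq : 0 < e / (2 * K')) by (apply Rdiv_lt_0_compat; [apply cond_pos|lra]).
  pose (s := Rpower (e / (2 * K')) (/ a)).
  assert (Hs : 0 < s) by apply Rpower_pos.
  assert (Es : Rpower s a = e / (2 * K')).
  { unfold s. rewrite Rpower_mult, Rinv_l, Rpower_1; lra. }
  assert (Hs2 : 0 < s / 2) by lra.
  exists (mkposreal _ Hs2); simpl; intros u w Hu Hw.
  pose (p := (u, clamp d w) : R * R). pose (q := (x, clamp d y) : R * R).
  fold p q.
  destruct (Req_dec u x) as [Eu|Nu]; [destruct (Req_dec (clamp d w) (clamp d y)) as [Ew|Nw]|].
  { unfold p, q; rewrite Eu, Ew, Rminus_diag, Rabs_R0. apply cond_pos. }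
  all: assert (Hpq : p <> q) by (unfold p, q; intro E; injection E; intros; contradiction).
  all: specialize (HK p q (clamp_in d w Hd) (clamp_in d y Hd) Hpq).
  all: set (nn := norm (minus p q)) in HK.
  all: assert (Hn : nn < s);
    [ eapply Rle_lt_trans; [apply norm_prod|];
      change (sqrt 2 * Rmax (Rabs (u - x)) (Rabs (clamp d w - clamp d y)) < s);
      pose proof (clamp_lipschitz d w y);
      assert (Rmax (Rabs (u - x)) (Rabs (clamp d w - clamp d y)) < s / 2)
        by (apply Rmax_lub_lt; lra);
      assert (0 <= Rmax (Rabs (u - x)) (Rabs (clamp d w - clamp d y)))
        by (eapply Rle_trans; [apply Rabs_pos|apply Rmax_l]);
      apply Rle_lt_trans with (2 * Rmax (Rabs (u - x)) (Rabs (clamp d w - clamp d y)));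
        [apply Rmult_le_compat_r; [assumption|]|lra];
      rewrite <- (sqrt_Rsqr 2) at 2 by lra; apply sqrt_le_1_alt; unfold Rsqr; lra |].
  all: assert (Hn0 : 0 < nn) by
    (destruct (norm_ge_0 (minus p q)) as [?|E0]; [assumption|];
     exfalso; apply Hpq; symmetry in E0; apply norm_eq_zero in E0;
     apply (plus_reg_r (opp q)); rewrite plus_opp_r; exact E0).
  all: assert (Hr : Rpower nn a <= e / (2 * K')) by (rewrite <- Es; apply Rpower_mono; lra).
  all: apply Rle_lt_trans with (K' * (e / (2 * K')));
    [ eapply Rle_trans; [exact HK|]; pose proof (Rpower_pos nn a); pose proof (Rle_abs K);
      apply Rle_trans with (K' * Rpower nn a);
        [apply Rmult_le_compat_r; unfold K'; lra|apply Rmult_le_compat_l; lra]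
    | replace (K' * (e / (2 * K'))) with (e / 2) by (field; lra); pose proof (cond_pos e); lra ].
Qed.

Lemma continuous_on_cont_strip d (f : R * R -> R) : 0 < d ->
  continuous_on (closed_strip d) f -> cont_strip d (fun x y => f (x, y)).
Proof.
  intros Hd H x y e.
  specialize (H (x, clamp d y) (clamp_in d y Hd)).
  apply filterlim_locally with (eps := e) in H. destruct H as [del Hdel].
  exists del; intros u w Hu Hw. apply (Hdel (u, clamp d w)).
  - split; [exact Hu|]. eapply Rle_lt_trans; [apply clamp_lipschitz|exact Hw].
  - now apply clamp_in.
Qed.

Lemma continuous_continuity_2d (f : R * R -> R) x y :
  continuous f (x, y) -> continuity_2d_pt (fun u v => f (u, v)) x y.
Proof.
  intros H. apply continuity_2d_pt_filterlim. apply filterlim_ext with f; auto.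
  intros [u v]; reflexivity.
Qed.

Section Extension.
Context (alpha d : R) (v : R -> R) (V Vx Vy : R * R -> R).
Context (Hd : 0 < d) (Ha : 0 < alpha) (HV : harmonic_extension alpha d v V Vx Vy).

Lemma extension_Vx_cont : cont_strip d (fun x y => Vx (x, y)).
Proof. apply (holder_cont_strip alpha); auto. apply HV. Qed.

Lemma extension_Vy_cont : cont_strip d (fun x y => Vy (x, y)).
Proof. apply (holder_cont_strip alpha); auto. apply HV. Qed.

Lemma extension_V_cont : cont_strip d (fun x y => V (x, y)).
Proof. apply continuous_on_cont_strip; auto. apply HV. Qed.

Lemma extension_Vx_eq (x y : R) : - d < y < 0 -> Vx (x, y) = dx V (x, y).
Proof. intros Hy. apply HV. exact Hy. Qed.

Lemma extension_Vy_eq (x y : R) : - d < y < 0 -> Vy (x, y) = dy V (x, y).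
Proof. intros Hy. apply HV. exact Hy. Qed.

Lemma extension_derive_x (x y : R) : - d < y < 0 -> is_derive (fun t => V (t, y)) x (Vx (x, y)).
Proof.
  intros Hy. rewrite extension_Vx_eq by auto. apply (Derive_correct (fun t => V (t, y))).
  destruct HV as [_ [_ [[H _] _]]]. apply (H (x, y) Hy).
Qed.

Lemma extension_derive_y (x y : R) : - d < y < 0 -> is_derive (fun t => V (x, t)) y (Vy (x, y)).
Proof.
  intros Hy. rewrite extension_Vy_eq by auto. apply (Derive_correct (fun t => V (x, t))).
  destruct HV as [_ [_ [[H _] _]]]. apply (H (x, y) Hy).
Qed.

Lemma extension_mixed (x y : R) : - d < y < 0 -> dy (dx V) (x, y) = dx (dy V) (x, y).
Proof.
  intros Hy. destruct HV as [_ [_ [[H1 [H2 [H3 _]]] _]]].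
  symmetry. apply (Schwarz (fun u w => V (u, w)) x y).
  - apply (locally_2d_strip d); auto; intros u w Hw.
    destruct (H1 (u, w) Hw) as [K1 [K2 _]].
    destruct (H2 (u, w) Hw) as [_ [K3 _]]. destruct (H3 (u, w) Hw) as [K4 _]. auto.
  - apply (continuous_continuity_2d (dx (dy V))). apply (H3 (x, y) Hy).
  - apply (continuous_continuity_2d (dy (dx V))). apply (H2 (x, y) Hy).
Qed.

Lemma derive_periodic (f : R -> R) x : periodic2pi f -> Derive f (x + 2 * PI) = Derive f x.
Proof.
  intros Hp. unfold Derive. f_equal. apply Lim_ext; intro t.
  rewrite Hp. replace (x + 2 * PI + t) with (x + t + 2 * PI) by ring. now rewrite Hp.
Qed.

Lemma extension_gradient_periodic (x y : R) : - d < y < 0 ->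
  Vy (x + 2 * PI, y) = Vy (x, y) /\ Vx (x + 2 * PI, y) = Vx (x, y).
Proof.
  intros Hy. destruct HV as [HP _]. rewrite !extension_Vx_eq, !extension_Vy_eq by auto.
  split.
  - unfold dy; simpl. apply Derive_ext_loc. apply (locally_strip d); auto; intros t Ht.
    apply HP; lra.
  - unfold dx; simpl. apply (derive_periodic (fun t => V (t, y))). intro t; apply HP; lra.
Qed.

(** [V_y + i V_x] is the complex derivative of [U + i V] for any [U] that makes this
   function holomorphic; here it is checked from the equality of mixed derivatives
   and the Laplace equation. *)
Lemma extension_holomorphic : holomorphic_strip d (fun x y => Vy (x, y)) (fun x y => Vx (x, y))
  (fun x y => dx (dy V) (x, y)) (fun x y => dx (dx V) (x, y)).
Proof.
  split; [apply extension_Vy_cont|]. split; [apply extension_Vx_cont|].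
  intros x y Hy. destruct (HV) as [_ [_ [[H1 [H2 [H3 H4]]] _]]].
  destruct (H2 (x, y) Hy) as [K1 [K2 [K3 _]]]. destruct (H3 (x, y) Hy) as [K4 [K5 [K6 _]]].
  split; [|split; [|now apply extension_gradient_periodic]].
  - refine (conj _ (conj _ (conj _ _))).
    + apply is_derive_ext with (fun t => dy V (t, y)).
      * intro t; symmetry; now apply extension_Vy_eq.
      * apply (Derive_correct (fun t => dy V (t, y))), K4.
    + cbv beta. assert (E : - dx (dx V) (x, y) = dy (dy V) (x, y)) by (specialize (H4 (x, y) Hy); lra).
      rewrite E.
      apply is_derive_ext_loc with (fun t => dy V (x, t)).
      * apply (locally_strip d); auto; intros t Ht; symmetry; now apply extension_Vy_eq.
      * apply (Derive_correct (fun t => dy V (x, t))), K5.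
    + apply is_derive_ext with (fun t => dx V (t, y)).
      * intro t; symmetry; now apply extension_Vx_eq.
      * apply (Derive_correct (fun t => dx V (t, y))), K1.
    + rewrite <- extension_mixed by auto.
      apply is_derive_ext_loc with (fun t => dx V (x, t)).
      * apply (locally_strip d); auto; intros t Ht; symmetry; now apply extension_Vx_eq.
      * apply (Derive_correct (fun t => dx V (x, t))), K2.
  - split; now apply continuous_continuity_2d.
Qed.

Lemma extension_top_periodic : periodic2pi (fun x => Vy (x, 0)).
Proof.
  intro x.
  assert (K := strip_closure d (fun y => Vy (x + 2 * PI, clamp d y) - Vy (x, clamp d y)) Hd).
  assert (E : Vy (x + 2 * PI, clamp d 0) - Vy (x, clamp d 0) = 0).
  { apply K; [| |lra].
    - apply cont_minus; apply (cont_strip_slice_y d (fun x y => Vy (x, y))), extension_Vy_cont.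
    - intros y Hy. rewrite clamp_id by lra.
      rewrite (proj1 (extension_gradient_periodic x y Hy)); ring. }
  rewrite clamp_id in E by lra. lra.
Qed.

Lemma extension_increment (a b y : R) : a <= b -> - d <= y <= 0 ->
  V (b, y) - V (a, y) = RInt (fun t => Vx (t, y)) a b.
Proof.
  intros Hab Hy.
  assert (E : V (b, clamp d y) - V (a, clamp d y) - RInt (fun t => Vx (t, clamp d y)) a b = 0).
  { apply (strip_closure d (fun y => V (b, clamp d y) - V (a, clamp d y)
             - RInt (fun t => Vx (t, clamp d y)) a b)); auto.
    - apply cont_minus; [apply cont_minus;
        apply (cont_strip_slice_y d (fun x y => V (x, y))), extension_V_cont|].
      apply (RInt_strip_cont d (fun x y => Vx (x, y))); auto using extension_Vx_cont.
    - intros z Hz. rewrite clamp_id by lra.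
      rewrite (is_RInt_unique (fun t => Vx (t, z)) a b (V (b, z) - V (a, z))); [ring|].
      apply (is_RInt_derive (fun t => V (t, z)) (fun t => Vx (t, z))).
      + intros t _; now apply extension_derive_x.
      + intros t _. apply (cont_strip_slice d (fun x y => Vx (x, y)) z); [lra|apply extension_Vx_cont]. }
  rewrite clamp_id in E by auto. lra.
Qed.

(** Up to the boundary lines, [V] is recovered along horizontals by integrating [V_x]:
   this holds inside, and both sides are continuous in [y]. *)
Lemma extension_boundary_derive (x y : R) : - d <= y <= 0 -> is_derive (fun t => V (t, y)) x (Vx (x, y)).
Proof.
  intros Hy.
  assert (C : cont (fun t => Vx (t, y)))
    by (apply (cont_strip_slice d (fun x y => Vx (x, y)) y); [lra|apply extension_Vx_cont]).
  apply is_derive_ext_loc with (fun b => V (x - 1, y) + RInt (fun t => Vx (t, y)) (x - 1) b).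
  - exists (mkposreal 1 Rlt_0_1); intros b Hb. change (Rabs (b - x) < 1) in Hb.
    apply Rabs_def2 in Hb. rewrite <- extension_increment by lra. apply Rplus_minus.
  - replace (Vx (x, y)) with (0 + Vx (x, y)) by ring.
    apply (is_derive_plus (fun _ => V (x - 1, y))); [exact (is_derive_const (V (x - 1, y)) x)|].
    apply (is_derive_RInt (fun t => Vx (t, y)) _ (x - 1)); [|apply C].
    apply filter_forall; intro; apply (RInt_correct (fun t => Vx (t, y))), cont_ex_RInt; auto.
Qed.

Lemma extension_top (x : R) : is_derive v x (Vx (x, 0)).
Proof.
  apply is_derive_ext with (fun t => V (t, 0)); [apply HV|].
  apply extension_boundary_derive; lra.
Qed.

Lemma extension_bottom (x : R) : Vx (x, - d) = 0.
Proof.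
  assert (H := extension_boundary_derive x (- d) ltac:(lra)).
  apply is_derive_unique in H. rewrite <- H.
  rewrite (Derive_ext _ (fun _ => 0)) by apply HV. apply Derive_const.
Qed.

(** The flux of [V - (y + d) V_y] is conserved, because the derivative of this function
   in [y] is [- (y + d) V_yy = ((y + d) V_x)_x].  It is zero on the bottom line. *)
Lemma extension_mean : d * period_int (fun x => Vy (x, 0)) = period_int v.
Proof.
  destruct extension_holomorphic as [CA [CB H]].
  assert (CV := extension_V_cont).
  assert (K : period_int (fun x => V (x, 0) - (0 + d) * Vy (x, 0))
              = period_int (fun x => V (x, - d) - (- d + d) * Vy (x, - d))).
  { apply (strip_conservation d (fun x y => V (x, y) - (y + d) * Vy (x, y))
      (fun x y => (y + d) * Vx (x, y)) (fun x y => (y + d) * dx (dx V) (x, y))); auto.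
    - intros x y. specialize (CA x y). specialize (CV x y). cont2.
      + apply (continuity_2d_pt_snd (clamp d)), cont_clamp.
      + apply continuity_2d_pt_const.
    - intros x y Hy. destruct (H x y Hy) as [[_ [D _]] _].
      replace ((y + d) * dx (dx V) (x, y))
        with (Vy (x, y) - (1 * Vy (x, y) + (y + d) * - dx (dx V) (x, y))) by ring.
      apply (is_derive_minus (fun t => V (x, t)) (fun t => (t + d) * Vy (x, t))).
      + now apply extension_derive_y.
      + apply (is_derive_mult (fun t => t + d) (fun t => Vy (x, t)) y 1); [| exact D | apply Rmult_comm].
        auto_derive; auto.
    - intros x y Hy. destruct (H x y Hy) as [[_ [_ [D _]]] _].
      apply (is_derive_tensor_y (fun t => Vx (t, y))), D.
    - intros x y Hy. destruct (H x y Hy) as [_ [[_ C] _]]. cont2.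
      + apply continuity_2d_pt_id2.
      + apply continuity_2d_pt_const.
    - intros x y Hy. destruct (H x y Hy) as [_ [_ [_ E]]]. now rewrite E. }
  destruct HV as [_ [_ [_ [HT HB]]]].
  rewrite (period_int_ext (fun x => V (x, - d) - _) (fun _ => 0)) in K by (intro; rewrite HB; ring).
  rewrite period_int_const, Rmult_0_r in K.
  assert (C0 : cont (fun x => Vy (x, 0))) by (apply (cont_strip_slice d (fun x y => Vy (x, y))); auto; lra).
  assert (Cv : cont v).
  { apply (is_derive_cont v (fun x => Vx (x, 0))). exact extension_top. }
  rewrite (period_int_lincomb v (fun x => Vy (x, 0)) _ 1 (- d)) in K; auto; [lra|].
  intro x. rewrite HT; ring.
Qed.

End Extension.

(** * Hölder calculus *)

Definition holder_exp (a : R) (w : R -> R) : Prop :=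
  periodic2pi w /\ cont w /\ exists K, holder_with a K w.

Lemma holder_exp_fun a w : 0 < a -> holder_exp a w -> holder_fun w.
Proof. intros Ha [Hp [Hc [K HK]]]. split; auto. split; auto. now exists a, K. Qed.

Lemma holder_with_cont a K f : 0 < a -> holder_with a K f -> cont f.
Proof.
  intros Ha [HK H]. apply cont_of_eps; intros x e He.
  assert (Hq : 0 < e / (2 * (K + 1))) by (apply Rdiv_lt_0_compat; lra).
  pose (s := Rpower (e / (2 * (K + 1))) (/ a)).
  assert (Hs : 0 < s) by apply Rpower_pos.
  assert (Es : Rpower s a = e / (2 * (K + 1))).
  { unfold s. rewrite Rpower_mult, Rinv_l, Rpower_1; lra. }
  exists s; split; auto; intros y Hy.
  destruct (Req_dec y x) as [->|Hne]; [rewrite Rminus_diag, Rabs_R0; auto|].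
  eapply Rle_lt_trans; [apply H|].
  assert (Hr : Rpower (Rabs (y - x)) a <= e / (2 * (K + 1))).
  { rewrite <- Es; apply Rpower_mono; auto. split; [apply Rabs_pos_lt; lra|lra]. }
  apply Rle_lt_trans with ((K + 1) * (e / (2 * (K + 1)))).
  - pose proof (Rpower_pos (Rabs (y - x)) a).
    apply Rmult_le_compat; lra.
  - replace ((K + 1) * (e / (2 * (K + 1)))) with (e / 2) by (field; lra). lra.
Qed.

Lemma holder_exp_const a c : holder_exp a (fun _ => c).
Proof.
  split; [intro; auto|]. split; [cont|]. exists 0; split; [lra|].
  intros x y; rewrite Rminus_diag, Rabs_R0; lra.
Qed.

Lemma holder_exp_lincomb a f g c d : holder_exp a f -> holder_exp a g ->
  holder_exp a (fun x => c * f x + d * g x).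
Proof.
  intros [Pf [Cf [K [HK Hf]]]] [Pg [Cg [L [HL Hg]]]].
  split; [intro x; now rewrite Pf, Pg|]. split; [cont|].
  exists (Rabs c * K + Rabs d * L). pose proof (Rabs_pos c). pose proof (Rabs_pos d).
  split; [nra|]. intros x y.
  replace (c * f x + d * g x - (c * f y + d * g y)) with (c * (f x - f y) + d * (g x - g y)) by ring.
  eapply Rle_trans; [apply Rabs_triang|]. rewrite !Rabs_mult, Rmult_plus_distr_r, !Rmult_assoc.
  apply Rplus_le_compat; apply Rmult_le_compat_l; auto.
Qed.

Lemma holder_exp_mult a f g : holder_exp a f -> holder_exp a g -> holder_exp a (fun x => f x * g x).
Proof.
  intros [Pf [Cf [K [HK Hf]]]] [Pg [Cg [L [HL Hg]]]].
  destruct (periodic_bounded f Pf Cf) as [M [HM BM]].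
  destruct (periodic_bounded g Pg Cg) as [M' [HM' BM']].
  split; [now apply periodic_mult|]. split; [cont|].
  exists (M * L + M' * K). split; [nra|]. intros x y.
  replace (f x * g x - f y * g y) with (f x * (g x - g y) + g y * (f x - f y)) by ring.
  eapply Rle_trans; [apply Rabs_triang|]. rewrite !Rabs_mult, Rmult_plus_distr_r, !Rmult_assoc.
  apply Rplus_le_compat; apply Rmult_le_compat; auto using Rabs_pos.
Qed.

Lemma holder_exp_ext a f g : (forall x, f x = g x) -> holder_exp a f -> holder_exp a g.
Proof.
  intros E [Pf [Cf [K [HK Hf]]]]. split; [intro x; now rewrite <- !E|].
  split; [now apply (cont_ext f)|]. exists K; split; auto; intros; rewrite <- !E; auto.
Qed.

Lemma Rpower_base_1 z : Rpower 1 z = 1.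
Proof. unfold Rpower; rewrite ln_1, Rmult_0_r; apply exp_0. Qed.

(** Lipschitz at distances at most [1], bounded at larger ones. *)
Lemma C1_holder_exp a (f f' : R -> R) : 0 < a < 1 -> periodic2pi f -> periodic2pi f' -> cont f' ->
  (forall x, is_derive f x (f' x)) -> holder_exp a f.
Proof.
  intros Ha Pf Pf' Cf' D. assert (Cf := is_derive_cont f f' D).
  destruct (periodic_bounded f Pf Cf) as [M [HM BM]].
  destruct (periodic_bounded f' Pf' Cf') as [M' [HM' BM']].
  split; auto. split; auto. exists (M' + 2 * M); split; [lra|]. intros x y.
  set (t := Rabs (x - y)). assert (Ht : 0 <= t) by apply Rabs_pos.
  assert (Hp := Rpower_pos t a).
  assert (HL : Rabs (f x - f y) <= M' * t).
  { destruct (MVT_gen f y x f') as [c [_ Hc]].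
    - intros; apply D.
    - intros; apply continuity_pt_filterlim, Cf.
    - rewrite Hc, Rabs_mult. apply Rmult_le_compat_r; auto. }
  assert (HB : Rabs (f x - f y) <= 2 * M).
  { eapply Rle_trans; [apply Rabs_triang|]. rewrite Rabs_Ropp.
    pose proof (BM x). pose proof (BM y). lra. }
  destruct (Req_dec t 0) as [E|Hne].
  { rewrite E, Rmult_0_r in HL. nra. }
  destruct (Rle_dec t 1) as [H1|H1].
  - assert (t <= Rpower t a).
    { rewrite <- (Rpower_1 t) at 1 by lra. replace 1 with (a + (1 - a)) at 1 by ring.
      rewrite Rpower_plus. rewrite <- (Rmult_1_r (Rpower t a)) at 2.
      apply Rmult_le_compat_l; [lra|]. apply Rle_trans with (Rpower 1 (1 - a)).
      - apply Rpower_mono; lra.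
      - rewrite Rpower_base_1; lra. }
    nra.
  - assert (1 <= Rpower t a) by (rewrite <- (Rpower_base_1 a); apply Rpower_mono; lra).
    nra.
Qed.

(** * The equivalence of the two formulations *)

(** With [f + i s = G], [a + i b] for the boundary value of [V_y + i V_x], and [s = - y b], the
   hypothesis says that [G ^ 2] is the product of [a + i b] with
   [(Z - y ^ 2) a - 2 y f - i (Z - y ^ 2) b]; this lemma and the next one divide by [a + i b]. *)
Lemma bernoulli_quotient_re a b f s y Z : a ^ 2 + b ^ 2 <> 0 -> s = - y * b ->
  (f + y * a) ^ 2 = Z * (b ^ 2 + a ^ 2) ->
  (a / (a ^ 2 + b ^ 2) * f - - b / (a ^ 2 + b ^ 2) * s) * f
  - (a / (a ^ 2 + b ^ 2) * s + - b / (a ^ 2 + b ^ 2) * f) * s = (Z - y ^ 2) * a - 2 * y * f.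
Proof.
  intros Hn -> HZ. replace Z with ((f + y * a) ^ 2 / (a ^ 2 + b ^ 2)) by (rewrite HZ; field; auto).
  field; auto.
Qed.

Lemma bernoulli_quotient_im a b f s y Z : a ^ 2 + b ^ 2 <> 0 -> s = - y * b ->
  (f + y * a) ^ 2 = Z * (b ^ 2 + a ^ 2) ->
  (a / (a ^ 2 + b ^ 2) * f - - b / (a ^ 2 + b ^ 2) * s) * s
  + (a / (a ^ 2 + b ^ 2) * s + - b / (a ^ 2 + b ^ 2) * f) * f = - (Z - y ^ 2) * b.
Proof.
  intros Hn -> HZ. replace Z with ((f + y * a) ^ 2 / (a ^ 2 + b ^ 2)) by (rewrite HZ; field; auto).
  field; auto.
Qed.

Section WaterWave.
Context (g k h Ups alpha m Q : R) (v : R -> R).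
Context (hk : 0 < k) (hh : 0 < h) (ha : 0 < alpha < 1).
Context (hv : holder_periodic 1 alpha v) (hmean : mean v = h).

Let v' := Derive v.
Let vv' := fun x => v x * v' x.
Let X := fun x => Q - 2 * g * v x - Ups ^ 2 * v x ^ 2.
Let Xv' := fun x => X x * v' x.
Let N := normal_der k h v.
Let F := flux_term k h Ups m v.

Lemma depth_pos : 0 < k * h.
Proof. now apply Rmult_lt_0_compat. Qed.

Lemma profile_derive x : is_derive v x (v' x).
Proof. apply Derive_correct. destruct hv as [_ [H _]]. exact (H 1%nat (le_n _) x). Qed.

Lemma profile_periodic : periodic2pi v.
Proof. apply hv. Qed.

Lemma slope_holder : holder_exp alpha v'.
Proof.
  destruct hv as [Hp [_ [K HK]]].
  assert (H : holder_with alpha (Rabs K) v').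
  { split; [apply Rabs_pos|]. intros x y. pose proof (Rpower_pos (Rabs (x - y)) alpha).
    destruct (Req_dec x y) as [->|Hne].
    - rewrite !Rminus_diag, Rabs_R0. apply Rmult_le_pos; [apply Rabs_pos|left; apply Rpower_pos].
    - eapply Rle_trans; [apply (HK x y I I Hne)|].
      change (norm (minus x y)) with (Rabs (x - y)).
      apply Rmult_le_compat_r; [lra|apply Rle_abs]. }
  split; [intro x; now apply derive_periodic|]. split; [|now exists (Rabs K)].
  apply (holder_with_cont alpha (Rabs K)); auto; lra.
Qed.

Lemma profile_holder : holder_exp alpha v.
Proof.
  pose proof slope_holder as [Ps [Cs _]].
  apply (C1_holder_exp alpha v v'); auto using profile_periodic, profile_derive.
Qed.

Lemma vv'_holder : holder_exp alpha vv'.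
Proof. apply holder_exp_mult; [apply profile_holder|apply slope_holder]. Qed.

Lemma Xv'_holder : holder_exp alpha Xv'.
Proof.
  apply holder_exp_mult; [|apply slope_holder].
  apply holder_exp_ext with (fun x => 1 * (Q * 1 + - 2 * g * v x) + - Ups ^ 2 * (v x * v x)).
  { intro x; unfold X; ring. }
  apply holder_exp_lincomb; [apply (holder_exp_lincomb alpha (fun _ => 1) v)|].
  - apply holder_exp_const.
  - apply profile_holder.
  - apply holder_exp_mult; apply profile_holder.
Qed.

Lemma mean_derivative_zero (f f' : R -> R) : periodic2pi f -> cont f' ->
  (forall x, is_derive f x (f' x)) -> mean f' = 0.
Proof.
  intros Pf Cf' D. rewrite mean_period_int, (period_int_derive f f'); auto.
  - unfold Rdiv; ring.
  - now apply periodic_ends.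
Qed.

Lemma slope_mean : mean v' = 0.
Proof.
  apply (mean_derivative_zero v); auto using profile_periodic, profile_derive. apply slope_holder.
Qed.

Lemma half_square_derive x : is_derive (fun t => v t ^ 2 / 2) x (vv' x).
Proof.
  assert (D := profile_derive x). auto_derive; [now exists (v' x)|].
  replace (Derive (fun t : R => v t) x) with (v' x) by reflexivity. unfold vv'; field.
Qed.

Lemma half_square_periodic : periodic2pi (fun t => v t ^ 2 / 2).
Proof. intro x; now rewrite profile_periodic. Qed.

Lemma vv'_mean : mean vv' = 0.
Proof.
  apply (mean_derivative_zero (fun t => v t ^ 2 / 2));
    auto using half_square_periodic, half_square_derive. apply vv'_holder.
Qed.

(** [X v'] is the derivative of a polynomial in [v]. *)
Lemma Xv'_mean : mean Xv' = 0.
Proof.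
  apply (mean_derivative_zero (fun t => Q * v t - g * v t ^ 2 - Ups ^ 2 * v t ^ 3 / 3)).
  - intro x; now rewrite profile_periodic.
  - apply Xv'_holder.
  - intro x. assert (D := profile_derive x). auto_derive; [repeat apply conj; try exact I; now exists (v' x)|].
    replace (Derive (fun t : R => v t) x) with (v' x) by reflexivity. unfold Xv', X; field.
Qed.

Lemma holder_alpha w : holder_exp alpha w -> holder_fun w.
Proof. apply holder_exp_fun; lra. Qed.

Lemma N_multiplier : multiplier (k * h) N v'.
Proof.
  apply (multiplier_hilbert (k * h) (1 / k) v'); auto using depth_pos, holder_alpha, slope_holder, slope_mean.
Qed.

Lemma F_multiplier : multiplier (k * h) F (fun x => - Ups * vv' x).
Proof.
  pose (c0 := m / (k * h) - Ups / (2 * (k * h)) * mean (fun t => v t ^ 2)).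
  apply (multiplier_ext _ _ _ _ _) with (3 := multiplier_lincomb _ c0 _ _ (- Ups) _ _ (multiplier_one (k * h))
    (multiplier_hilbert (k * h) 0 vv' depth_pos (holder_alpha _ vv'_holder) vv'_mean)); intro x.
  - unfold F, flux_term, c0. fold v'. fold vv'. change (fun t => v t * Derive v t) with vv'. ring.
  - ring.
Qed.

Lemma N_periodic : periodic2pi N.
Proof. intro x; unfold N, normal_der; now rewrite strip_hilbert_periodic. Qed.

Lemma F_periodic : periodic2pi F.
Proof. intro x; unfold F, flux_term; now rewrite strip_hilbert_periodic. Qed.

Lemma N_cont : cont N.
Proof. apply N_multiplier. Qed.

Lemma F_cont : cont F.
Proof. apply F_multiplier. Qed.

Lemma v_cont : cont v.
Proof. apply profile_holder. Qed.

Lemma v'_cont : cont v'.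
Proof. apply slope_holder. Qed.

Let Bernoulli := fun x => (F x + Ups * v x * N x) ^ 2 - (Q - 2 * g * v x) * (v' x ^ 2 + N x ^ 2).

(** By (E1), [P] is a boundary function, hence so is [G ^ 2 - P f]; it is real, so it is
   constant, and by (E2) its mean is zero. *)
Lemma E1_E2_imply_B : equation_E1 g k h Ups m Q v -> equation_E2 g k h Ups m Q v ->
  equation_B g k h Ups m Q v.
Proof.
  intros H1 H2.
  pose proof v_cont. pose proof v'_cont. pose proof N_cont. pose proof F_cont. pose proof PI_RGT_0.
  pose (c := - ((Q - 2 * Ups * m - 2 * g * h) / k)
              + 2 * g * mean (fun t => v t * strip_hilbert (k * h) (Derive v) t)).
  (* minus the boundary value of [P], whose real part is read off from (E1) *)
  assert (MP : multiplier (k * h) (fun x => 2 * Ups * v x * F x - X x * N x) Xv').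
  { apply (multiplier_ext _ _ _ _ _) with (3 := multiplier_hilbert (k * h) c Xv' depth_pos
      (holder_alpha _ Xv'_holder) Xv'_mean); intro x; auto.
    specialize (H1 x). unfold c, X, N, F.
    change (fun t => (Q - 2 * g * v t - Ups ^ 2 * v t ^ 2) * Derive v t) with Xv' in H1. lra. }
  assert (SB : strip_boundary (k * h) Bernoulli (fun _ => 0)).
  { apply (strip_boundary_ext _ _ _ _ _) with (3 := strip_boundary_lincomb _
      1 _ _ 1 _ _ (proj2 (proj2 N_multiplier) _ _ (multiplier_boundary _ _ _ MP))
      (proj2 (proj2 F_multiplier) _ _ (multiplier_boundary _ _ _ F_multiplier))); intro x;
    unfold Bernoulli, Xv', vv', X; ring. }
  assert (PB : periodic2pi Bernoulli).
  { intro x. unfold Bernoulli. rewrite profile_periodic, F_periodic, N_periodic.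
    now rewrite (proj1 slope_holder). }
  assert (E := strip_boundary_real_const _ _ depth_pos PB SB).
  assert (MB : mean Bernoulli = 0).
  { rewrite <- H2, !mean_period_int. unfold Bernoulli. rewrite period_int_minus by cont.
    fold F N v'. unfold Rdiv; ring. }
  intro x. specialize (E x). rewrite MB in E. exact E.
Qed.

Lemma B_imply_E2 : equation_B g k h Ups m Q v -> equation_E2 g k h Ups m Q v.
Proof.
  intros HB.
  pose proof v_cont. pose proof v'_cont. pose proof N_cont. pose proof F_cont.
  unfold equation_E2. rewrite !mean_period_int. fold F N v'.
  assert (E : period_int Bernoulli = 0).
  { rewrite (period_int_ext _ (fun _ => 0)); [rewrite period_int_const; ring|exact HB]. }
  unfold Bernoulli in E. rewrite period_int_minus in E by cont.
  unfold Rdiv. rewrite <- Rmult_minus_distr_r, E; ring.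
Qed.

(** In the expansion of the product, the integrals of [v ^ 2] cancel because [mean v = h],
   and those of [v ^ 2 * C v'] and [v * C (v v')] cancel by the symmetry of [u |-> C u']. *)
Lemma E1_mean : mean (fun x => X x * N x - 2 * Ups * v x * F x)
  = (Q - 2 * Ups * m - 2 * g * h) / k - 2 * g * mean (fun t => v t * strip_hilbert (k * h) v' t).
Proof.
  pose proof PI_RGT_0. pose proof v_cont.
  pose (T := strip_hilbert (k * h) v'). pose (W := strip_hilbert (k * h) vv').
  assert (CH : cont T) by (apply strip_hilbert_cont; auto using depth_pos, holder_alpha, slope_holder).
  assert (CW : cont W) by (apply strip_hilbert_cont; auto using depth_pos, holder_alpha, vv'_holder).
  assert (IH : period_int T = 0) by (apply strip_hilbert_mean; auto using depth_pos, holder_alpha, slope_holder).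
  assert (Iv : period_int v = 2 * PI * h).
  { rewrite <- hmean, mean_period_int; field; lra. }
  assert (Isym : period_int (fun x => W x * v x) = period_int (fun x => T x * v x ^ 2) / 2).
  { unfold W; rewrite (hilbert_derive_symmetric (k * h) (fun t => v t ^ 2 / 2) vv' v v');
      auto using depth_pos, half_square_periodic, profile_periodic, half_square_derive,
        profile_derive, holder_alpha, slope_holder, vv'_holder.
    fold T. rewrite (period_int_scal (fun x => T x * v x ^ 2) _ (1 / 2)); cont; [field|intro; field]. }
  pose (c0 := m / (k * h) - Ups / (2 * (k * h)) * mean (fun t => v t ^ 2)).
  assert (E : period_int (fun x => X x * N x - 2 * Ups * v x * F x)
    = Q / k * period_int (fun _ => 1) + Q * period_int T + (- 2 * g / k - 2 * Ups * c0) * period_int v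
      + - 2 * g * period_int (fun x => v x * T x) + - Ups ^ 2 / k * period_int (fun x => v x ^ 2)
      + - Ups ^ 2 * period_int (fun x => T x * v x ^ 2) + 2 * Ups ^ 2 * period_int (fun x => W x * v x)).
  { 
    rewrite <- (period_int_lincomb (fun _ => 1) T (fun x => Q / k * 1 + Q * T x)) by (cont || auto).
    rewrite <- (Rmult_1_l (period_int (fun x => Q / k * 1 + Q * T x))).
    rewrite <- (period_int_lincomb (fun x => Q / k * 1 + Q * T x) v
      (fun x => 1 * (Q / k * 1 + Q * T x) + (- 2 * g / k - 2 * Ups * c0) * v x)) by (cont || auto).
    set (f1 := fun x => 1 * (Q / k * 1 + Q * T x) + (- 2 * g / k - 2 * Ups * c0) * v x).
    assert (C1 : cont f1) by (unfold f1; cont).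
    rewrite <- (Rmult_1_l (period_int f1)).
    rewrite <- (period_int_lincomb f1 (fun x => v x * T x)
      (fun x => 1 * f1 x + - 2 * g * (v x * T x))) by (cont || auto).
    set (f2 := fun x => 1 * f1 x + - 2 * g * (v x * T x)).
    assert (C2 : cont f2) by (unfold f2; cont).
    rewrite <- (Rmult_1_l (period_int f2)).
    rewrite <- (period_int_lincomb f2 (fun x => v x ^ 2)
      (fun x => 1 * f2 x + - Ups ^ 2 / k * v x ^ 2)) by (cont || auto).
    set (f3 := fun x => 1 * f2 x + - Ups ^ 2 / k * v x ^ 2).
    assert (C3 : cont f3) by (unfold f3; cont).
    rewrite <- (Rmult_1_l (period_int f3)).
    rewrite <- (period_int_lincomb f3 (fun x => T x * v x ^ 2)
      (fun x => 1 * f3 x + - Ups ^ 2 * (T x * v x ^ 2))) by (cont || auto).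
    set (f4 := fun x => 1 * f3 x + - Ups ^ 2 * (T x * v x ^ 2)).
    assert (C4 : cont f4) by (unfold f4; cont).
    rewrite <- (Rmult_1_l (period_int f4)).
    rewrite <- (period_int_lincomb f4 (fun x => W x * v x)
      (fun x => 1 * f4 x + 2 * Ups ^ 2 * (W x * v x))) by (cont || auto).
    apply period_int_ext; intro x. unfold f4, f3, f2, f1, X, N, F, normal_der, flux_term.
    fold v'. change (fun t => v t * v' t) with vv'. fold T. fold W. fold c0. field; lra. }
  rewrite !mean_period_int, E, Isym, IH, Iv, period_int_const. fold T. unfold c0. rewrite mean_period_int.
  field; repeat split; lra.
Qed.

(** On the top line [G ^ 2 = P f], and [1 / f] is a boundary function because [f] has no
   zero; multiplying it twice by [G] shows that [P] is one.  So the left-hand side of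
   (E1) is a constant, which [E1_mean] evaluates. *)
Lemma B_imply_E1 V Vx Vy : harmonic_extension alpha (k * h) v V Vx Vy ->
  (forall p, closed_strip (k * h) p -> Vx p ^ 2 + Vy p ^ 2 <> 0) ->
  equation_B g k h Ups m Q v -> equation_E1 g k h Ups m Q v.
Proof.
  intros HV Hne HB.
  pose proof v_cont. pose proof v'_cont. pose proof N_cont. pose proof F_cont. pose proof PI_RGT_0.
  pose proof depth_pos as Hd.
  assert (Ha : 0 < alpha) by lra.
  assert (Hol := extension_holomorphic alpha (k * h) v V Vx Vy Hd Ha HV).
  assert (Evx : forall x, Vx (x, 0) = v' x).
  { intro x. symmetry. apply is_derive_unique. now apply (extension_top alpha (k * h) v V Vx Vy). }
  assert (Evy : forall x, Vy (x, 0) = N x).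
  { assert (S := holomorphic_strip_boundary _ _ _ _ _ Hd Hol
                   (extension_bottom alpha (k * h) v V Vx Vy Hd Ha HV)).
    apply (strip_boundary_ext _ _ _ (fun x => Vy (x, 0)) v') in S; auto.
    intro x. rewrite (strip_boundary_conjugate (k * h) (fun x => Vy (x, 0)) v' Hd
      (extension_top_periodic alpha (k * h) v V Vx Vy Hd Ha HV) (holder_alpha _ slope_holder) S).
    unfold N, normal_der. fold v'. f_equal.
    assert (M := extension_mean alpha (k * h) v V Vx Vy Hd Ha HV).
    assert (Iv : period_int v = 2 * PI * h) by (rewrite <- hmean, mean_period_int; field; lra).
    rewrite !mean_period_int, strip_hilbert_mean by auto using holder_alpha, slope_holder.
    rewrite Iv in M.
    replace (period_int (fun x => Vy (x, 0))) with (2 * PI * h / (k * h)).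
    - field; lra.
    - rewrite <- M; field; lra. }
  assert (Hn : forall x, N x ^ 2 + v' x ^ 2 <> 0).
  { intro x. rewrite <- Evx, <- Evy, Rplus_comm. apply Hne. unfold closed_strip; simpl; lra. }
  assert (Sq : strip_boundary (k * h) (fun x => N x / (N x ^ 2 + v' x ^ 2))
                 (fun x => - v' x / (N x ^ 2 + v' x ^ 2))).
  { assert (Hi := holomorphic_inv _ _ _ _ _ Hd Hol).
    apply (strip_boundary_ext _ _ _ _ _) with (3 := holomorphic_strip_boundary _ _ _ _ _ Hd
      (Hi (fun x y Hy => fun E => Hne (x, y) Hy (eq_trans (Rplus_comm _ _) E)))
      (fun x => ltac:(cbv beta; rewrite (extension_bottom alpha (k * h) v V Vx Vy Hd Ha HV x);
                      unfold Rdiv; ring))); intro x; now rewrite Evx, Evy. }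
  (* [- P = - G ^ 2 / f] *)
  assert (SP : strip_boundary (k * h) (fun x => - (X x * N x - 2 * Ups * v x * F x)) Xv').
  { assert (S2 := proj2 (proj2 F_multiplier) _ _ (proj2 (proj2 F_multiplier) _ _ Sq)).
    apply (strip_boundary_ext _ _ _ _ _) with (3 := strip_boundary_lincomb _ (-1) _ _ 0 _ _ S2 Sq);
      intro x; specialize (Hn x); specialize (HB x); fold F N v' in HB.
    - rewrite (bernoulli_quotient_re (N x) (v' x) (F x) (- Ups * vv' x) (Ups * v x) (Q - 2 * g * v x));
        auto; [unfold X; ring|unfold vv'; ring|lra].
    - rewrite (bernoulli_quotient_im (N x) (v' x) (F x) (- Ups * vv' x) (Ups * v x) (Q - 2 * g * v x));
        auto; [unfold Xv', X; ring|unfold vv'; ring|lra]. }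
  assert (PP : periodic2pi (fun x => - (X x * N x - 2 * Ups * v x * F x))).
  { intro x. unfold X. now rewrite profile_periodic, F_periodic, N_periodic. }
  assert (K := strip_boundary_conjugate _ _ _ Hd PP (holder_alpha _ Xv'_holder) SP).
  intro x. specialize (K x).
  assert (CX : cont (fun x => X x * N x - 2 * Ups * v x * F x)) by (unfold X; cont).
  assert (EM := E1_mean).
  rewrite mean_period_int in EM.
  rewrite !mean_period_int, strip_hilbert_mean in K by auto using holder_alpha, Xv'_holder.
  rewrite (period_int_scal (fun x => X x * N x - 2 * Ups * v x * F x) _ (-1)) in K; auto; [|intro; ring].
  fold N F. change (fun t => (Q - 2 * g * v t - Ups ^ 2 * v t ^ 2) * Derive v t) with Xv'.
  fold v'. change (Q - 2 * g * v x - Ups ^ 2 * v x ^ 2) with (X x).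
  unfold Rdiv in *. lra.
Qed.
End WaterWave.

Theorem theorem1 (g k h Ups alpha : R)
    (hg : 0 < g) (hk : 0 < k) (hh : 0 < h) (halpha : 0 < alpha < 1)
    (m Q : R) (v : R -> R)
    (hv : holder_periodic 1 alpha v) (hmean : mean v = h) :
  (equation_E1 g k h Ups m Q v /\ equation_E2 g k h Ups m Q v ->
     equation_B g k h Ups m Q v) /\
  (forall V Vx Vy : R * R -> R,
     harmonic_extension alpha (k * h) v V Vx Vy ->
     equation_B g k h Ups m Q v ->
     (forall p : R * R, closed_strip (k * h) p -> Vx p ^ 2 + Vy p ^ 2 <> 0) ->
     equation_E1 g k h Ups m Q v /\ equation_E2 g k h Ups m Q v).
Proof.
  split.
  - intros [H1 H2]. now apply (E1_E2_imply_B g k h Ups alpha m Q v).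
  - intros V Vx Vy HV HB Hne. split.
    + now apply (B_imply_E1 g k h Ups alpha m Q v) with V Vx Vy.
    + now apply (B_imply_E2 g k h Ups alpha m Q v).
Qed.
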